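(* Let $(\mathcal{X},\mathcal{B},\mu)$ be a probability space and let $\mathcal{E}\colon \mathrm{Dom}(\mathcal{E})\times\mathrm{Dom}(\mathcal{E})\to\mathbb{R}$ be a symmetric nonnegative definite bilinear form satisfying Assumption A (see context). Then the modified log-Sobolev inequality $$\rho_0\,\mathrm{Ent}_\mu(f)\le \mathcal{E}(f,\log f)\quad\text{for all nonnegative } f\in\mathrm{Dom}(\mathcal{E}) \text{ with } \log f\in\mathrm{Dom}(\mathcal{E})$$ holds with some constant $\rho_0>0$ if and only if the Beckner inequality $$\alpha_p\bigl(\mu(f^p)-\mu(f)^p\bigr)\le \frac p2\,\mathcal{E}(f,f^{p-1})\quad\text{for all nonnegative } f\in\mathrm{Dom}(\mathcal{E}) \text{ with } f^{p-1}\in\mathrm{Dom}(\mathcal{E})$$ holds for every $p\in(1,2]$ with some constants $\alpha_p>0$ bounded away from zero (i.e. $\inf_{p\in(1,2]}\alpha_p>0$). Moreover, the optimal constants $\rho_0^{\mathrm{opt}}(\mu)$, $\alpha_p^{\mathrm{opt}}(\mu)$ with which these inequalities hold satisfy $\rho_0^{\mathrm{opt}}(\mu)=2\lim_{p\to1^+}\alpha_p^{\mathrm{opt}}(\mu)$.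
   Context: $L_0(\mathcal{X},\mu)$ is the space of $\mathcal{B}$-measurable real functions on $\mathcal{X}$; $\mathrm{Dom}(\mathcal{E})$ is a linear subspace of $L_0(\mathcal{X},\mu)$. Notation: $\mu(f)=\int_{\mathcal{X}} f\,d\mu$; $\mathrm{Ent}_\mu(f)=\mu(f\log f)-\mu(f)\log\mu(f)$ for $f\ge0$. Assumption A: (1) if $\varphi\colon\mathbb{R}\to\mathbb{R}$ is a contraction (1-Lipschitz) and $f\in\mathrm{Dom}(\mathcal{E})$, then $\varphi\circ f\in\mathrm{Dom}(\mathcal{E})$; (2) for any $f_1,f_2,g_1,g_2\in\mathrm{Dom}(\mathcal{E})$, if $(f_1(x)-f_1(y))(f_2(x)-f_2(y))\le (g_1(x)-g_1(y))(g_2(x)-g_2(y))$ for all $x,y\in\mathcal{X}$, then $\mathcal{E}(f_1,f_2)\le\mathcal{E}(g_1,g_2)$. The optimal constant is the largest constant with which the given inequality holds. Convention: an estimate $A\le B$ means ''if $B<\infty$, then $A$ is well-defined and the inequality holds''; in particular functional inequalities assert that their left-hand sides are well-defined. *)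

(* Defs.v *)
From mathcomp Require Import all_boot all_order all_algebra.
From mathcomp Require Import all_classical all_reals all_analysis.

Set Implicit Arguments.
Unset Strict Implicit.
Unset Printing Implicit Defensive.

Import Order.TTheory GRing.Theory Num.Theory.
Import numFieldNormedType.Exports.

Local Open Scope classical_set_scope.
Local Open Scope ring_scope.

(* The form is represented by a total function E, constrained only on its
   domain Dom. Elements of Dom are genuine functions, not classes modulo
   almost everywhere equality. *)
Record symmetric_nonneg_form (d : measure_display) (T : measurableType d)
    (R : realType) (Dom : set (T -> R)) (E : (T -> R) -> (T -> R) -> R) : Prop := {
  form_measurable : forall f, Dom f -> measurable_fun [set: T] f ;
  form_dom0 : Dom (cst 0) ;
  form_domP : forall (a : R) f g, Dom f -> Dom g -> Dom (a \*o f \+ g) ;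
  form_sym : forall f g, Dom f -> Dom g -> E f g = E g f ;
  form_linear : forall (a : R) f g h, Dom f -> Dom g -> Dom h ->
    E (a \*o f \+ g) h = a * E f h + E g h ;
  form_ge0 : forall f, Dom f -> 0 <= E f f
}.

Record assumptionA (d : measure_display) (T : measurableType d)
    (R : realType) (Dom : set (T -> R)) (E : (T -> R) -> (T -> R) -> R) : Prop := {
  assumptionA_contraction : forall (phi : R -> R) f,
    1.-lipschitz phi -> Dom f -> Dom (phi \o f) ;
  assumptionA_le : forall f1 f2 g1 g2, Dom f1 -> Dom f2 -> Dom g1 -> Dom g2 ->
    (forall x y, (f1 x - f1 y) * (f2 x - f2 y) <= (g1 x - g1 y) * (g2 x - g2 y)) ->
    E f1 f2 <= E g1 g2
}.

Section inequalities.
Context (d : measure_display) (T : measurableType d) (R : realType).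
Variable mu : probability T R.

(* Below, the integrals of nonnegative functions and of f log f (bounded from
   below by - 1 / e) always exist in ]-oo, +oo]; thus a left-hand side a - b is
   well-defined exactly when it is not of the form +oo - +oo, i.e. when
   a +? - b. In \bar R, +oo - +oo is the junk value -oo. *)
Definition mean (f : T -> R) : \bar R := (\int[mu]_x (f x)%:E)%E.

Definition Ent (f : T -> R) : \bar R :=
  (mean (fun x => f x * ln (f x))%R - mean f * lne (mean f))%E.

Definition Ent_defined (f : T -> R) : Prop :=
  (mean (fun x => f x * ln (f x))%R +? - (mean f * lne (mean f)))%E.

Definition pEnt (p : R) (f : T -> R) : \bar R :=
  (mean (fun x => f x `^ p)%R - mean f `^ p)%E.

Definition pEnt_defined (p : R) (f : T -> R) : Prop :=
  (mean (fun x => f x `^ p)%R +? - (mean f `^ p))%E.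

Variables (Dom : set (T -> R)) (E : (T -> R) -> (T -> R) -> R).

(* Elements of Dom are real-valued, so log f in Dom forces f > 0 everywhere;
   this has to be explicit because of the junk value ln 0 = 0. *)
Definition mLSI (rho : R) : Prop :=
  forall f, Dom f -> (forall x, 0 < f x) -> Dom (fun x => ln (f x)) ->
    Ent_defined f /\ (rho%:E * Ent f <= (E f (fun x => ln (f x)))%:E)%E.

Definition Beckner (p alpha : R) : Prop :=
  forall f, Dom f -> (forall x, 0 <= f x) -> Dom (fun x => f x `^ (p - 1)) ->
    pEnt_defined p f /\
    (alpha%:E * pEnt p f <= (p / 2 * E f (fun x => f x `^ (p - 1)))%R%:E)%E.

End inequalities.

(* The largest nonnegative constant satisfying P, with value in [0, +oo]: it is
   +oo if P holds for arbitrarily large constants (e.g. if Dom contains only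
   constant functions), and 0 if P holds for no positive constant. *)
Definition optimal_constant (R : realType) (P : R -> Prop) : \bar R :=
  ereal_sup [set c%:E | c in [set c : R | c = 0 \/ 0 < c /\ P c]].

(* Main.v *)
(** Put [eps = p - 1].

    From Beckner to mLSI: for bounded [f], dividing the Beckner inequality by
    [eps] and letting [p] tend to 1, the left-hand side tends to [Ent f], and
    the right-hand side is controlled by [E f (ln f)] through the two-point
    inequality [x^eps - y^eps <= eps M^eps (ln x - ln y)] for [y <= x <= M].

    From mLSI to Beckner: let [q u = (e^u - 1) / u], [psi x = x ln x - x + 1] and
    [F (e^s) = e^s q (eps s)]. Then
    - [a^p - 1 - p (a - 1) <= eps psi (F a)];
    - on [[e^-D, +oo[], [(F a - F b) (ln (F a) - ln (F b))] is at most
      [p^2 e^(eps D) / eps (a - b) (a^eps - b^eps)].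
    Truncate [F] below at [e^-D] and choose a scaling [c] with [mu (F (c f)) = 1],
    so that [Ent (F (c f)) = mu (psi (F (c f)))], which dominates the Bregman
    divergence [c^p (mu (f^p) - mu (f)^p) / eps] up to the factor
    [psi (e^-D)]. Applying the mLSI to [F (c f)] yields Beckner with constant
    [rho psi (e^-D) / (2 p e^(eps D))]; letting [p] tend to 1 and then [D] to
    infinity gives [rho / 2].

    Unbounded functions are reached by truncation, using Fatou's lemma. Their
    integrability comes from the convention that left-hand sides are
    well-defined, applied to [max f c]. *)
Require Import Defs.
From mathcomp Require Import all_boot all_order all_algebra.
From mathcomp Require Import all_classical all_reals all_analysis.
From mathcomp Require Import ring lra.

Set Implicit Arguments.
Unset Strict Implicit.
Unset Printing Implicit Defensive.

Import Order.TTheory GRing.Theory Num.Theory.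
Import numFieldNormedType.Exports.

Local Open Scope classical_set_scope.
Local Open Scope ring_scope.

(** * Two-point inequalities *)

Section real_inequalities.
Context {R : realType}.
Implicit Types (u v s t x y eps : R).

(** Convexity of the exponential, in tangent form at [u]; several scalar estimates below are
    combinations of its instances. *)
Lemma expR_tangent u v : expR u * (1 + v - u) <= expR v.
Proof.
rewrite -[in leRHS](subrK u v) expRD mulrC -addrA ler_wpM2r ?expR_ge0//.
exact: expR_ge1Dx.
Qed.

(** The average of the exponential between [0] and [u], extended continuously at [0]; this is the
    [q] of the header. *)
Definition expq u : R := if u == 0 then 1 else (expR u - 1) / u.

Lemma mul_expq u : u * expq u = expR u - 1.
Proof.
rewrite /expq; case: eqP => [->|/eqP u0]; first by rewrite mul0r expR0 subrr.
by rewrite mulrC divfK.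
Qed.

Lemma expq0 : expq 0 = 1. Proof. by rewrite /expq eqxx. Qed.

Lemma expq_le1 u : u <= 0 -> expq u <= 1.
Proof.
rewrite le_eqVlt => /predU1P[->|u0]; first by rewrite expq0.
by rewrite -(ler_nM2l u0) mul_expq mulr1; have := expR_ge1Dx u; lra.
Qed.

Lemma expq_ge1 u : 0 <= u -> 1 <= expq u.
Proof.
rewrite le_eqVlt => /predU1P[<-|u0]; first by rewrite expq0.
by rewrite -(ler_pM2l u0) mul_expq mulr1; have := expR_ge1Dx u; lra.
Qed.

Lemma expqN u : expR u * expq (- u) = expq u.
Proof.
have [->|u0] := eqVneq u 0; first by rewrite oppr0 expq0 expR0 mulr1.
apply: (mulfI u0); rewrite mul_expq mulrCA -[u in LHS]opprK mulNr opprK mul_expq.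
by rewrite mulrN mulrBr mulr1 -expRD subrr expR0 opprB.
Qed.

(** After cross-multiplication this is convexity with [u] between [0] and [v]: the tangent at [u] is
    evaluated at [v] and at [0], with weights [u] and [v - u]. *)
Lemma expq_le_pos u v : 0 <= u -> u <= v -> expq u <= expq v.
Proof.
rewrite le_eqVlt => /predU1P[<-|u0 uv]; first by rewrite expq0; apply: expq_ge1.
have v0 : 0 < v by apply: lt_le_trans uv.
rewrite -(ler_pM2l u0) -(ler_pM2l v0) mul_expq mulrCA mul_expq.
have H1 := ler_wpM2l (ltW u0) (expR_tangent u v).
have vu : 0 <= v - u by lra.
have H2 := ler_wpM2l vu (expR_tangent u 0).
rewrite expR0 in H2; nra.
Qed.

Lemma expq_gt0 u : 0 < expq u.
Proof.
have [u0|u0] := leP 0 u; first exact: lt_le_trans ltr01 (expq_ge1 u0).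
rewrite -expqN mulr_gt0 ?expR_gt0//.
by apply: lt_le_trans ltr01 (expq_ge1 _); rewrite oppr_ge0 ltW.
Qed.

Lemma expq_le u v : u <= v -> expq u <= expq v.
Proof.
move=> uv; have [u0|u0] := leP 0 u; first exact: expq_le_pos.
have [v0|v0] := leP 0 v.
  exact: le_trans (expq_le1 (ltW u0)) (expq_ge1 v0).
rewrite -(ler_nM2l u0) -(ler_nM2l v0) mul_expq mulrCA mul_expq.
have Nv0 : 0 <= - v by lra.
have H1 := ler_wpM2l Nv0 (expR_tangent v u).
have vu : 0 <= v - u by lra.
have H2 := ler_wpM2l vu (expR_tangent v 0).
rewrite expR0 in H2; nra.
Qed.

(** By the reflection [expqN], this is monotonicity at the opposite points. It makes [ln (expq u)]
    1-Lipschitz in [u]. *)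
Lemma expq_expR_le u v : u <= v -> expq v <= expR (v - u) * expq u.
Proof.
move=> uv; rewrite -(expqN v) -(expqN u) expRD mulrA -(mulrA (expR v)).
rewrite -expRD addNr expR0 mulr1 ler_pM2l ?expR_gt0//.
by apply: expq_le; rewrite lerN2.
Qed.

(* On [u, v], the average [expR u * expq (v - u)] of the exponential dominates
   its average [expq v] over [0, v] when [0 <= u]. *)
Lemma expq_shift u v : 0 <= u -> expq v <= expR u * expq (v - u).
Proof.
move=> u0; rewrite -(expqN v) -(expqN (v - u)) mulrA -expRD addrCA subrr addr0.
by rewrite ler_pM2l ?expR_gt0// expq_le// opprB lerDr.
Qed.

Lemma ln_le_subr1 x : 0 < x -> ln x <= x - 1.
Proof. by move=> x0; have := @le_ln1Dx R (x - 1); rewrite (addrC 1) subrK; apply; lra. Qed.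

Definition psi x : R := x * ln x - x + 1.

Lemma psi_ge0 x : 0 <= x -> 0 <= psi x.
Proof.
rewrite /psi le_eqVlt => /predU1P[<-|x0]; first by rewrite mul0r subr0 add0r.
have xV0 : 0 < x^-1 by rewrite invr_gt0.
have := ler_wpM2l (ltW x0) (ln_le_subr1 xV0).
by rewrite lnV ?posrE// mulrN mulrBr mulfV ?gt_eqF// mulr1; lra.
Qed.

(* The function [F] of the header in the variable [s = ln a]. *)
Definition link eps s : R := expR s * expq (eps * s).

Lemma link_gt0 eps s : 0 < link eps s.
Proof. by rewrite mulr_gt0 ?expR_gt0 ?expq_gt0. Qed.

Lemma ln_link eps s : ln (link eps s) = s + ln (expq (eps * s)).
Proof. by rewrite lnM ?posrE ?expR_gt0 ?expq_gt0// expRK. Qed.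

(* The defect in this inequality is [eps * expR s * psi (expq (eps * s))]. *)
Lemma le_psi_link eps s : 0 < eps ->
  expR ((1 + eps) * s) - 1 - (1 + eps) * (expR s - 1) <= eps * psi (link eps s).
Proof.
move=> e0; rewrite /psi ln_link /link mulrDl mul1r expRD.
set a := expR s; have a0 : 0 < a := expR_gt0 _.
have := mul_expq (eps * s); set h := expq _; set b := expR _ => hE.
have /(mulr_ge0 (mulr_ge0 (ltW e0) (ltW a0))) := psi_ge0 (ltW (expq_gt0 (eps * s))).
rewrite /psi -/h => H; rewrite -subr_ge0.
suff -> : eps * (a * h * (s + ln h) - a * h + 1) -
   (a * b - 1 - (1 + eps) * (a - 1)) = eps * a * (h * ln h - h + 1) by [].
have -> : b = eps * s * h + 1 by rewrite hE subrK.
ring.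
Qed.

(** [ln (link eps s)] is the sum of [s] and [ln (expq (eps * s))], both nondecreasing, with slopes
    at most [1] and [eps]. *)
Lemma ln_link_lip eps s t : 0 <= eps -> t <= s ->
  0 <= ln (link eps s) - ln (link eps t) <= (1 + eps) * (s - t).
Proof.
move=> e0 ts; have est : eps * t <= eps * s by rewrite ler_wpM2l.
rewrite !ln_link; apply/andP; split.
  have := expq_le est; rewrite -ler_ln ?posrE ?expq_gt0//; lra.
have := expq_expR_le est.
rewrite -ler_ln ?posrE ?mulr_gt0 ?expR_gt0 ?expq_gt0//.
rewrite lnM ?posrE ?expR_gt0 ?expq_gt0// expRK.
by set A := ln _; set B := ln _; rewrite -mulrBr; nra.
Qed.

(** One factor [1 + eps] comes from the increment of [link], the other from that of its logarithm;
    the remaining [expq (eps * s) * (s - t)] is compared with the increment of the power. *)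
Lemma link_two_point_le eps D s t : 0 < eps -> 0 <= D -> - D <= t -> t <= s ->
  (link eps s - link eps t) * (ln (link eps s) - ln (link eps t)) <=
  (1 + eps) ^+ 2 * expR (eps * D) / eps *
    ((expR s - expR t) * (expR (eps * s) - expR (eps * t))).
Proof.
move=> e0 D0 Dt ts.
have est : eps * t <= eps * s by rewrite ler_wpM2l// ltW.
have := ln_link_lip (ltW e0) ts => /andP[L0 L1].
have hs0 := expq_gt0 (eps * s); have ht0 := expq_gt0 (eps * t).
have ab : expR t <= expR s by rewrite ler_expR.
(* The left-hand side is [(a - b) * hs + b * (hs - ht)]. The growth bound on [expq] gives
   [hs - ht <= eps * (s - t) * hs], and convexity gives [b * (s - t) <= a - b]. *)
have F1 : link eps s - link eps t <= (1 + eps) * (expR s - expR t) * expq (eps * s).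
  rewrite /link.
  have := expq_expR_le est; rewrite -mulrBr.
  set a := expR s; set b := expR t; set hs := expq (eps * s) in hs0 *.
  set ht := expq (eps * t) in ht0 *.
  move=> /(ler_wpM2l (expR_ge0 (- (eps * (s - t))))).
  rewrite mulrA -expRD addNr expR0 mul1r => H.
  have H2 := expR_ge1Dx (- (eps * (s - t))).
  have H3 : b * (s - t) <= a - b.
    by have := expR_tangent t s; rewrite -/a -/b; lra.
  have H4 : hs * (1 - eps * (s - t)) <= ht.
    by apply: le_trans H; rewrite mulrC ler_wpM2r// ltW.
  have b0 : 0 <= b := expR_ge0 _.
  have H5 : b * (hs * (1 - eps * (s - t))) <= b * ht by rewrite ler_wpM2l.
  have H6 : eps * hs * (b * (s - t)) <= eps * hs * (a - b).
    by rewrite ler_wpM2l// mulr_ge0 ?ltW.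
  have -> : a * hs - b * ht = (a - b) * hs + b * hs - b * ht by ring.
  lra.
have F2 : expq (eps * s) * (s - t) <=
    expR (eps * D) / eps * (expR (eps * s) - expR (eps * t)).
  have E1 : expR (eps * s) - expR (eps * t) =
      expR (eps * t) * (eps * (s - t) * expq (eps * (s - t))).
    rewrite mul_expq mulrBr -expRD mulr1 mulrBr; congr (expR _ - _); ring.
  rewrite E1.
  have -> : expR (eps * D) / eps *
      (expR (eps * t) * (eps * (s - t) * expq (eps * (s - t)))) =
      expR (eps * D) * expR (eps * t) * expq (eps * (s - t)) * (s - t).
    by field; rewrite gt_eqF.
  rewrite -expRD -mulrDr ler_wpM2r ?subr_ge0//.
  (* For [0 <= t] this is [expq_shift]. For [t < 0], [s <= s - t] and [expq] is nondecreasing, while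
     [- D <= t] makes the exponential prefactor at least 1. *)
  have [t0|t0] := leP 0 t.
    apply: (@le_trans _ _ (expR (eps * t) * expq (eps * (s - t)))).
      by rewrite mulrBr expq_shift// mulr_ge0// ltW.
    by rewrite ler_wpM2r ?(ltW (expq_gt0 _))// ler_expR ler_wpM2l ?(ltW e0)//; lra.
  apply: (@le_trans _ _ (expq (eps * (s - t)))).
    by rewrite expq_le// ler_wpM2l ?(ltW e0)//; lra.
  rewrite ler_peMl ?(ltW (expq_gt0 _))// -expR0 ler_expR mulr_ge0 ?(ltW e0)//; lra.
have e1 : 0 <= 1 + eps by lra.
apply: (@le_trans _ _ (((1 + eps) * (expR s - expR t) * expq (eps * s)) *
                        ((1 + eps) * (s - t)))).
  by rewrite ler_pM// subr_ge0 -ler_ln ?posrE ?link_gt0//; lra.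
have ab0 : 0 <= expR s - expR t by rewrite subr_ge0.
have := ler_wpM2l (mulr_ge0 (mulr_ge0 e1 e1) ab0) F2.
set a := expR s; set b := expR t.
lra.
Qed.

End real_inequalities.

(** * Scalar inequalities in the logarithmic variable *)

Section exponential_inequalities.
Context {R : realType}.
Implicit Types (r q s t x y eps D : R).

(** The Bregman divergence [a^p - 1 - p (a - 1)] of the power [p = 1 + eps], at [a = e^r]. *)
Definition pow_gap eps r : R :=
  expR ((1 + eps) * r) - 1 - (1 + eps) * (expR r - 1).

Lemma pow_gapE eps r :
  pow_gap eps r = expR r * (expR (eps * r) - 1) - eps * (expR r - 1).
Proof. by rewrite /pow_gap mulrDl mul1r expRD; ring. Qed.

Lemma psi_expR_le_pow_gap eps r : eps * psi (expR r) <= pow_gap eps r.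
Proof.
rewrite pow_gapE /psi expRK.
have := ler_wpM2l (expR_ge0 r) (expR_ge1Dx (eps * r)); lra.
Qed.

Lemma pow_gap_ge0 eps r : 0 <= eps -> 0 <= pow_gap eps r.
Proof.
move=> e0; apply: le_trans (psi_expR_le_pow_gap eps r).
by rewrite mulr_ge0// psi_ge0 ?expR_ge0.
Qed.

Lemma pow_gap_le eps r : 0 <= eps -> r <= 0 -> pow_gap eps r <= eps.
Proof.
move=> e0 r0; rewrite pow_gapE.
have : expR (eps * r) <= 1 by rewrite -expR0 ler_expR mulr_ge0_le0.
rewrite -subr_le0 => /(mulr_ge0_le0 (expR_ge0 r)).
have := mulr_ge0 e0 (expR_ge0 r); lra.
Qed.

Lemma psi_expRN_le1 D : 0 <= D -> psi (expR (- D)) <= 1.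
Proof.
move=> D0; rewrite /psi expRK.
have := mulr_ge0 (expR_ge0 (- D)) D0; have := expR_ge0 (- D); lra.
Qed.

Lemma psi_expRNE D : psi (expR (- D)) = expR (- D) * (expR D - (1 + D)).
Proof. by rewrite /psi expRK !mulrBr -expRD addNr expR0; ring. Qed.

Lemma psi_expRN_gt0 D : 0 < D -> 0 < psi (expR (- D)).
Proof.
move=> D0; rewrite psi_expRNE.
by rewrite mulr_gt0 ?expR_gt0// subr_gt0 expR_gt1Dx// gt_eqF.
Qed.

Lemma psi_expRN_near1 (c : R) : c < 1 -> exists2 D, 0 < D & c < psi (expR (- D)).
Proof.
move=> c1; have cpos : 0 < 1 - c by lra.
(* This gives [1 < D] and [4 < D * (1 - c)], so that [(1 - c) * (D ^+ 2 / 2) > 2 * D > 1 + D], and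
   the quadratic lower bound on [expR D] suffices. *)
pose D : R := 1 + 4 / (1 - c).
have D1 : 1 < D by rewrite /D ltrDl divr_gt0.
have D4 : 4 < D * (1 - c) by rewrite /D mulrDl divfK ?gt_eqF//; lra.
exists D; first lra.
rewrite psi_expRNE mulrBr -expRD addNr expR0 ltrBrDr -ltrBrDl mulrC expRN.
rewrite ltr_pdivrMr ?expR_gt0//.
have := @expR_ge1Dxn R D 1 (ltac:(lra)); rewrite /= => H.
apply: (@lt_le_trans _ _ ((1 - c) * (1 + D ^+ 2 / 2))); last by rewrite ler_pM2l.
have : 4 * D < D * (1 - c) * D by rewrite ltr_pM2r//; lra.
rewrite expr2; lra.
Qed.

(** Above [- D] nothing is truncated and [psi (expR (- D)) <= 1] is harmless. Below, the gap is at
    most [eps], while [psi (link eps (- D))] is at least [psi (expR (- D))]; this is the price of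
    the truncation. *)
Lemma pow_gap_le_psi_link eps D r : 0 < eps -> 0 <= D ->
  psi (expR (- D)) * pow_gap eps r <= eps * psi (link eps (Num.max r (- D))).
Proof.
move=> e0 D0; have k0 : 0 <= psi (expR (- D)) by rewrite psi_ge0 ?expR_ge0.
have k1 := psi_expRN_le1 D0.
have [rD|Dr] := leP r (- D).
  apply: (@le_trans _ _ (eps * psi (expR (- D)))).
    by rewrite mulrC ler_wpM2r// pow_gap_le ?(ltW e0)//; lra.
  exact: le_trans (psi_expR_le_pow_gap _ _) (le_psi_link _ _).
apply: le_trans (le_psi_link _ e0).
by rewrite -[leRHS]mul1r ler_wpM2r// pow_gap_ge0// ltW.
Qed.

(** If both points lie below [- D], the left-hand side vanishes. Otherwise truncation can only raise
    the smaller one, which shrinks the increments on the right. *)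
Lemma link_max_two_point_le eps D r q : 0 < eps -> 0 <= D ->
  (link eps (Num.max r (- D)) - link eps (Num.max q (- D))) *
    (ln (link eps (Num.max r (- D))) - ln (link eps (Num.max q (- D)))) <=
  (1 + eps) ^+ 2 * expR (eps * D) / eps *
    ((expR r - expR q) * (expR (eps * r) - expR (eps * q))).
Proof.
move=> e0 D0; wlog qr : r q / q <= r.
  move=> H; have [|/ltW] := leP q r; first exact: H.
  by move=> /H{H} ?; lra.
have C0 : 0 <= (1 + eps) ^+ 2 * expR (eps * D) / eps.
  by rewrite divr_ge0 ?(ltW e0)// mulr_ge0 ?sqr_ge0 ?expR_ge0.
set s := Num.max r _; set t := Num.max q _.
have Dt : - D <= t by rewrite le_max lexx orbT.
have ts : t <= s by rewrite /s /t ge_max !le_max qr lexx orbT.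
apply: le_trans (link_two_point_le e0 D0 Dt ts) _.
rewrite ler_wpM2l//.
have eqr : eps * q <= eps * r by rewrite ler_wpM2l// ltW.
have [Dr|rD] := leP (- D) r; last first.
  have -> : s = t by rewrite /s /t !max_r ?ltW// (le_lt_trans qr).
  by rewrite subrr mul0r mulr_ge0// subr_ge0 ler_expR.
have -> : s = r by rewrite /s max_l.
have qt : q <= t by rewrite le_max lexx.
have tr : t <= r by rewrite /t ge_max qr.
have etr : eps * t <= eps * r by rewrite ler_wpM2l// ltW.
by rewrite ler_pM ?subr_ge0 ?ler_expR// lerB// ler_expR// ler_wpM2l// ltW.
Qed.

Lemma expR_sub_le r q : expR r - expR q <= expR r * (r - q).
Proof. have := expR_tangent r q; lra. Qed.

Lemma expR_ln_two_point_le eps B r q : 0 <= eps -> r <= B -> q <= B ->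
  (expR r - expR q) * (expR (eps * r) - expR (eps * q)) <=
  eps * expR (eps * B) * ((expR r - expR q) * (r - q)).
Proof.
move=> e0; wlog qr : r q / q <= r.
  by move=> H rB qB; have [/H/(_ rB qB)//|/ltW/H/(_ qB rB){H} ?] := leP q r; lra.
move=> rB _; rewrite mulrCA ler_wpM2l ?subr_ge0 ?ler_expR//.
apply: le_trans (expR_sub_le _ _) _; rewrite -mulrBr.
have -> : eps * expR (eps * B) * (r - q) = expR (eps * B) * (eps * (r - q)) by ring.
by rewrite ler_wpM2r ?mulr_ge0 ?subr_ge0// ler_expR ler_wpM2l.
Qed.

(** Together with [expR_mul_le], brackets the difference quotient of [c |-> e^(c r)] at [c = 1]; the
    lower bound is meant for integration, the upper one for the logarithm of the mean. *)
Lemma expR_mul_ge eps r : eps * (expR r * r) <= expR ((1 + eps) * r) - expR r.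
Proof.
rewrite mulrDl mul1r expRD.
have := ler_wpM2l (expR_ge0 r) (expR_ge1Dx (eps * r)); lra.
Qed.

Lemma expR_mul_le eps r : expR ((1 + eps) * r) - expR r <=
  eps * (expR ((1 + eps) * r) * r).
Proof.
have := expR_tangent ((1 + eps) * r) r; lra.
Qed.

Lemma expR_nondecreasing_lipschitz B r q : q <= r -> r <= B ->
  0 <= expR r - expR q <= expR B * (r - q).
Proof.
move=> qr rB; rewrite subr_ge0 ler_expR qr/=.
by apply: le_trans (expR_sub_le _ _) _; rewrite ler_wpM2r ?subr_ge0// ler_expR.
Qed.

Lemma ln_nondecreasing_lipschitz (eta : R) x y : 0 < eta -> eta <= y -> y <= x ->
  0 <= ln x - ln y <= eta^-1 * (x - y).
Proof.
move=> e0 ey yx; have y0 := lt_le_trans e0 ey; have x0 := lt_le_trans y0 yx.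
rewrite subr_ge0 ler_ln ?posrE// yx/= -ln_div ?posrE//.
apply: le_trans (ln_le_subr1 _) _; first by rewrite divr_gt0.
have -> : x / y - 1 = y^-1 * (x - y) by field; rewrite gt_eqF.
by rewrite ler_wpM2r ?subr_ge0// lef_pV2.
Qed.

(** With [x = e^r] and [y = e^q], the increment is [e^q (e^(r - q) - 1)]. Since [1 <= y] gives
    [0 <= q], multiplying [q] and [r] by [eps <= 1] decreases both factors. *)
Lemma powR_nondecreasing_lipschitz eps x y : 0 <= eps <= 1 -> 1 <= y -> y <= x ->
  0 <= x `^ eps - y `^ eps <= x - y.
Proof.
move=> /andP[e0 e1] y1 yx.
have y0 : 0 < y by lra. have x0 : 0 < x by lra.
rewrite subr_ge0 ge0_ler_powR ?nnegrE ?(ltW y0) ?(ltW x0)//=.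
rewrite /powR !gt_eqF//.
have q0 := ln_ge0 y1; have qr : ln y <= ln x by rewrite ler_ln.
have -> : x - y = expR (ln x) - expR (ln y) by rewrite !lnK.
set q := ln y in q0 qr *; set r := ln x in qr *.
have -> : expR r - expR q = expR q * (expR (r - q) - 1).
  by rewrite mulrBr -expRD addrCA subrr addr0 mulr1.
have -> : expR (eps * r) - expR (eps * q) = expR (eps * q) * (expR (eps * (r - q)) - 1).
  by rewrite !mulrBr -expRD addrCA subrr addr0 mulr1.
rewrite ler_pM ?expR_ge0 ?subr_ge0 ?ler_expR ?lerB//.
- by rewrite -expR0 ler_expR mulr_ge0 ?subr_ge0.
- by rewrite -[leRHS]mul1r ler_wpM2r.
- by rewrite ler_expR -[leRHS]mul1r ler_wpM2r ?subr_ge0.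
Qed.

End exponential_inequalities.

(** * Forms and truncations *)

Section forms.
Context (d : measure_display) (T : measurableType d) (R : realType).
Variables (Dom : set (T -> R)) (E : (T -> R) -> (T -> R) -> R).
Hypotheses (hE : symmetric_nonneg_form Dom E) (hA : assumptionA Dom E).
Implicit Types (f g : T -> R).

Lemma dom_scale (a : R) f : Dom f -> Dom (fun x => a * f x).
Proof.
move=> Df; have := form_domP hE a Df (form_dom0 hE).
by congr Dom; apply/funext => x /=; rewrite addr0.
Qed.

Lemma form0l g : Dom g -> E (cst 0) g = 0.
Proof.
move=> Dg; have D0 := form_dom0 hE; have := form_linear hE 1 D0 D0 Dg.
have -> : 1 \*o cst 0 \+ cst 0 = cst 0 :> (T -> R).
  by apply/funext => x /=; rewrite mulr0 addr0.
by move=> ?; lra.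
Qed.

Lemma form_scale (a : R) f g : Dom f -> Dom g -> E (fun x => a * f x) g = a * E f g.
Proof.
move=> Df Dg; have := form_linear hE a Df (form_dom0 hE) Dg.
rewrite form0l// addr0 => <-; congr E.
by apply/funext => x /=; rewrite addr0.
Qed.

(** Assumption A carries no constant, so [K] is absorbed into [g1] by linearity. *)
Lemma form_le_scale (K : R) f1 f2 g1 g2 :
  Dom f1 -> Dom f2 -> Dom g1 -> Dom g2 ->
  (forall x y, (f1 x - f1 y) * (f2 x - f2 y) <=
               K * ((g1 x - g1 y) * (g2 x - g2 y))) ->
  E f1 f2 <= K * E g1 g2.
Proof.
move=> Df1 Df2 Dg1 Dg2 fg; rewrite -form_scale//.
apply: (assumptionA_le hA) => //; first exact: dom_scale.
by move=> x y; rewrite -mulrBr -mulrA.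
Qed.

(** Assumption A compares [E f g] with [E 0 g], which is zero. *)
Lemma form_ge0_of f g : Dom f -> Dom g ->
  (forall x y, 0 <= (f x - f y) * (g x - g y)) -> 0 <= E f g.
Proof.
move=> Df Dg fg; rewrite -(form0l Dg).
by apply: (assumptionA_le hA) => //= [|x y]; [exact: (form_dom0 hE)|rewrite subrr mul0r].
Qed.

(* [pi] is a projection onto the range where [phi] is Lipschitz. *)
Lemma dom_comp (K : R) (phi pi : R -> R) f : 0 < K ->
  (forall y x, y <= x -> 0 <= pi x - pi y <= x - y) ->
  (forall y x, pi y <= pi x ->
    0 <= phi (pi x) - phi (pi y) <= K * (pi x - pi y)) ->
  Dom f -> Dom (fun z => phi (pi (f z))).
Proof.
move=> K0 pi1 phiK Df.
have -> : (fun z => phi (pi (f z))) = (fun z => K * ((fun u => K^-1 * phi (pi u)) \o f) z).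
  by apply/funext => z /=; rewrite mulVKf// gt_eqF.
apply: dom_scale; apply: (assumptionA_contraction hA) => //.
move=> [x y] _ /=; rewrite mul1r -mulrBr normrM gtr0_norm ?invr_gt0//.
rewrite ler_pdivrMl//; wlog yx : x y / y <= x => [H|].
  by have [/H//|/ltW/H] := leP y x; rewrite distrC (distrC y).
have /andP[p0 p1] := pi1 _ _ yx.
have /andP[f0 f1] := phiK y x (ltac:(by rewrite -subr_ge0)).
rewrite (ger0_norm f0) ger0_norm ?subr_ge0//; apply: le_trans f1 _.
by rewrite ler_pM2l.
Qed.

Lemma max_contraction (a : R) y x : y <= x ->
  0 <= Num.max x a - Num.max y a <= x - y.
Proof. by move=> yx; rewrite /Num.max; case: ltP => ?; case: ltP => ?; lra. Qed.

Lemma min_contraction (a : R) y x : y <= x ->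
  0 <= Num.min x a - Num.min y a <= x - y.
Proof. by move=> yx; rewrite /Num.min; case: ltP => ?; case: ltP => ?; lra. Qed.

Lemma dom_max (a : R) f : Dom f -> Dom (fun x => Num.max (f x) a).
Proof.
move=> Df; apply: (@dom_comp 1 id (Num.max^~ a)) => // [y x|y x yx].
  exact: max_contraction.
by rewrite subr_ge0 yx mul1r /=.
Qed.

Lemma dom_min (a : R) f : Dom f -> Dom (fun x => Num.min (f x) a).
Proof.
move=> Df; apply: (@dom_comp 1 id (Num.min^~ a)) => // [y x|y x yx].
  exact: min_contraction.
by rewrite subr_ge0 yx mul1r /=.
Qed.

Lemma dom_addr (a : R) f : Dom f -> Dom (fun x => f x + a).
Proof.
move=> Df; apply: (@dom_comp 1 (+%R^~ a) id) => // [y x yx|y x yx].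
  by rewrite subr_ge0 yx lexx.
by rewrite /= mul1r opprD addrACA subrr addr0 subr_ge0 yx lexx.
Qed.

(** The exponential is Lipschitz only below [B]; capping [f] at [B] does not change it and places it
    in the scope of [dom_comp]. The logarithm and the powers are treated likewise. *)
Lemma dom_expR (B : R) f : (forall x, f x <= B) -> Dom f ->
  Dom (fun x => expR (f x)).
Proof.
move=> fB Df; have -> : (fun x => expR (f x)) = (fun x => expR (Num.min (f x) B)).
  by apply/funext => x; rewrite min_l.
apply: (@dom_comp (expR B) expR (Num.min^~ B)) => // [|y x|y x yx].
- exact: expR_gt0.
- exact: min_contraction.
- by apply: expR_nondecreasing_lipschitz => //; rewrite ge_min lexx orbT.
Qed.

Lemma dom_ln (eta : R) f : 0 < eta -> (forall x, eta <= f x) -> Dom f ->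
  Dom (fun x => ln (f x)).
Proof.
move=> eta0 fB Df; have -> : (fun x => ln (f x)) = (fun x => ln (Num.max (f x) eta)).
  by apply/funext => x; rewrite max_l.
apply: (@dom_comp (eta^-1) (@ln R) (Num.max^~ eta)) => // [|y x|y x yx].
- by rewrite invr_gt0.
- exact: max_contraction.
- by apply: ln_nondecreasing_lipschitz => //; rewrite le_max lexx orbT.
Qed.

Lemma dom_ln_link eps f : 0 <= eps -> Dom f -> Dom (fun x => ln (link eps (f x))).
Proof.
move=> e0 Df; apply: (@dom_comp (1 + eps) (fun s => ln (link eps s)) id) => //.
- lra.
- by move=> y x yx; rewrite subr_ge0 yx lexx.
- by move=> y x; exact: ln_link_lip.
Qed.

Lemma dom_powR eps f : 0 <= eps <= 1 -> (forall x, 1 <= f x) -> Dom f ->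
  Dom (fun x => f x `^ eps).
Proof.
move=> e01 f1 Df.
have -> : (fun x => f x `^ eps) = (fun x => Num.max (f x) 1 `^ eps).
  by apply/funext => x; rewrite max_l.
apply: (@dom_comp 1 ((@powR R)^~ eps) (Num.max^~ 1)) => // [y x|y x yx].
- exact: max_contraction.
- by rewrite mul1r; apply: powR_nondecreasing_lipschitz => //; rewrite le_max lexx orbT.
Qed.

End forms.

(** * Two-sided truncation of positive numbers *)

Section truncation.
Context {R : realType}.
Implicit Types (x a b : R) (n : nat).

(** The two levels are inverse to each other, so that [ln (clip n x)] ranges over a symmetric
    interval. *)
Definition clip n x : R := Num.max (Num.min x n.+1%:R) n.+1%:R^-1.

Lemma clip_ge n x : n.+1%:R^-1 <= clip n x.
Proof. by rewrite le_max lexx orbT. Qed.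

Lemma clip_gt0 n x : 0 < clip n x.
Proof. by apply: lt_le_trans (clip_ge n x); rewrite invr_gt0. Qed.

Lemma clip_le n x : clip n x <= n.+1%:R.
Proof.
rewrite ge_max ge_min lexx orbT/= (@le_trans _ _ 1) ?ler1n//.
by rewrite invf_le1// ler1n.
Qed.

Lemma clip_le_add1 n x : 0 <= x -> clip n x <= x + 1.
Proof.
move=> x0; rewrite ge_max ge_min; apply/andP; split; first by rewrite lerDl ler01.
by rewrite (@le_trans _ _ 1) ?lerDr// invf_le1// ler1n.
Qed.

Lemma cvg_clip x : 0 <= x -> clip n x @[n --> \oo] --> x.
Proof.
move=> x0; apply: (@squeeze_cvgr _ _ _ _ (cst x) (fun n => x + n.+1%:R^-1)).
- near=> n; have xn : x <= n.+1%:R.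
    rewrite -natr1 ler_wpDr//; near: n; exact: nbhs_infty_ger.
  rewrite /clip min_l// le_max lexx/= ge_max lerDl lerDr x0 andbT.
  by rewrite invr_ge0.
- exact: cvg_cst.
- by rewrite -[X in _ --> X]addr0; apply: cvgD; [exact: cvg_cst|exact: cvg_harmonic].
Unshelve. all: by end_near. Qed.

Lemma clip_contraction n y x : y <= x -> 0 <= clip n x - clip n y <= x - y.
Proof.
move=> yx; have /andP[H1 H2] := min_contraction n.+1%:R yx.
have /andP[H3 H4] := @max_contraction _ n.+1%:R^-1 (Num.min y n.+1%:R)
  (Num.min x n.+1%:R) (ltac:(by rewrite -subr_ge0)).
by rewrite H3/= (le_trans H4).
Qed.

Lemma measurable_clip n : measurable_fun [set: R] (clip n).
Proof.
apply: measurable_realfun.measurable_maxr => //.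
exact: measurable_realfun.measurable_minr.
Qed.

(** A nondecreasing [g] commutes with [min] and [max], so [g (clip n x)] is a truncation of [g x].
    The set [I] is where [g] is monotone: the positive reals for [ln], the nonnegative ones for
    powers. *)
Lemma comp_clip_contraction (I : set R) (g : R -> R) n y x :
  (forall a, 0 < a -> I a) -> (forall a b, I a -> I b -> a <= b -> g a <= g b) ->
  I y -> I x -> y <= x -> 0 <= g (clip n x) - g (clip n y) <= g x - g y.
Proof.
move=> posI gI Iy Ix yx.
have Imin a b : I a -> 0 < b -> I (Num.min a b).
  by rewrite /Num.min; case: ifP => // _ _ /posI.
have gmin a b : I a -> 0 < b -> g (Num.min a b) = Num.min (g a) (g b).
  move=> Ia /posI Ib; have [ab|/ltW ba] := leP a b; first by rewrite min_l// gI.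
  by rewrite min_r// gI.
have gmax a b : I a -> 0 < b -> g (Num.max a b) = Num.max (g a) (g b).
  move=> Ia /posI Ib; have [ab|/ltW ba] := leP a b; first by rewrite max_r// gI.
  by rewrite max_l// gI.
have N0 : 0 < n.+1%:R :> R by [].
have NV0 : 0 < n.+1%:R^-1 :> R by rewrite invr_gt0.
have gyx := gI _ _ Iy Ix yx.
rewrite /clip !gmax ?gmin//; try exact: Imin.
have /andP[H1 H2] := min_contraction (g n.+1%:R) gyx.
have /andP[H3 H4] := @max_contraction _ (g n.+1%:R^-1) (Num.min (g y) (g n.+1%:R))
  (Num.min (g x) (g n.+1%:R)) (ltac:(by rewrite -subr_ge0)).
by rewrite H3/= (le_trans H4).
Qed.

(** Through Assumption A, this makes [E f (g \o f)] decrease when [f] is truncated. *)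
Lemma comp_clip_two_point_le (I : set R) (g : R -> R) n x y :
  (forall a, 0 < a -> I a) -> (forall a b, I a -> I b -> a <= b -> g a <= g b) ->
  I x -> I y ->
  (clip n x - clip n y) * (g (clip n x) - g (clip n y)) <= (x - y) * (g x - g y).
Proof.
move=> posI gI; wlog yx : x y / y <= x => [H Ix Iy|Ix Iy].
  have [|/ltW] := leP y x; first by move/H; exact.
  by move=> /H/(_ Iy Ix){H} ?; lra.
have /andP[? ?] := clip_contraction n yx.
have /andP[? ?] := comp_clip_contraction n posI gI Iy Ix yx.
exact: ler_pM.
Qed.

End truncation.

(** * Means and passage to the limit in the truncation *)

Section means.
Context (d : measure_display) (T : measurableType d) (R : realType).
Variable mu : probability T R.
Implicit Types f g : T -> R.

Lemma bounded_integrable (a b : R) f : measurable_fun [set: T] f ->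
  (forall x, a <= f x <= b) -> mu.-integrable [set: T] (EFin \o f).
Proof.
move=> mf fab; apply: measurable_bounded_integrable => //.
  by rewrite (le_lt_trans (probability_le1 mu _))// ltry.
exists (Num.max `|a| `|b|); split; first exact: num_real.
move=> M MM x _ /=; apply: le_trans (ltW MM).
have /andP[fa fb] := fab x.
by rewrite le_max; rewrite !ler_normr !ler_norml; case: (leP 0 (f x)) => ?; lra.
Qed.

Lemma mean_integrable f : mu.-integrable [set: T] (EFin \o f) ->
  mean mu f = (\int[mu]_x f x)%:E.
Proof. by move=> If; rewrite /Rintegral fineK//; exact: integrable_fin_num. Qed.

Lemma integrable_mean f : measurable_fun [set: T] f -> (forall x, 0 <= f x) ->
  (mean mu f < +oo)%E -> mu.-integrable [set: T] (EFin \o f).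
Proof.
move=> mf f0 foo; apply/integrableP; split; first exact/measurable_realfun.measurable_EFinP.
by under eq_integral do rewrite /= ger0_norm//.
Qed.

Lemma le_mean f g : measurable_fun [set: T] f -> measurable_fun [set: T] g ->
  (forall x, 0 <= f x) ->
  (forall x, f x <= g x) -> (mean mu f <= mean mu g)%E.
Proof.
move=> mf mg f0 fg; apply: ge0_le_integral => //.
- by move=> x _; rewrite lee_fin.
- exact/measurable_realfun.measurable_EFinP.
- exact/measurable_realfun.measurable_EFinP.
- by move=> x _; rewrite lee_fin.
Qed.

Lemma Rintegral_probability_cst (a : R) : \int[mu]_x cst a x = a.
Proof.
rewrite Rintegral_cst//; have -> : fine (mu [set: T]) = 1 by rewrite probability_setT.
by rewrite mulr1.
Qed.

Lemma Rintegral_ge (a : R) f : mu.-integrable [set: T] (EFin \o f) ->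
  (forall x, a <= f x) -> a <= \int[mu]_x f x.
Proof.
move=> If af; rewrite -(Rintegral_probability_cst a); apply: le_Rintegral => // .
by apply: (@bounded_integrable a a) => // x; rewrite lexx.
Qed.

Lemma Rintegral_le (a : R) f : mu.-integrable [set: T] (EFin \o f) ->
  (forall x, f x <= a) -> \int[mu]_x f x <= a.
Proof.
move=> If af; rewrite -(Rintegral_probability_cst a); apply: le_Rintegral => // .
by apply: (@bounded_integrable a a) => // x; rewrite lexx.
Qed.

Lemma integrable_clip n f : measurable_fun [set: T] f ->
  mu.-integrable [set: T] (EFin \o (fun x => clip n (f x))).
Proof.
move=> mf; apply: (@bounded_integrable 0 n.+1%:R) => [|x].
  by apply: (measurableT_comp (measurable_clip n)).
by rewrite clip_le ltW// clip_gt0.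
Qed.

Lemma mean_clip_gt0 n f : measurable_fun [set: T] f ->
  0 < \int[mu]_x clip n (f x).
Proof.
move=> mf; apply: (@lt_le_trans _ _ n.+1%:R^-1); first by rewrite invr_gt0.
by apply: Rintegral_ge => [|x]; [exact: integrable_clip|exact: clip_ge].
Qed.

Lemma mean_cvg_clip f : measurable_fun [set: T] f -> (forall x, 0 <= f x) ->
  (mean mu f < +oo)%E ->
  \int[mu]_x clip n (f x) @[n --> \oo] --> \int[mu]_x f x.
Proof.
move=> mf f0 foo; have If := integrable_mean mf f0 foo.
have mc n : measurable_fun [set: T] (fun x => clip n (f x)).
  by apply: (measurableT_comp (measurable_clip n)).
have Ic n := integrable_clip n mf.
(* The dominating function is [f + 1], since [clip n] may raise small values, though never above
   1. *)
have I1 : mu.-integrable [set: T] (EFin \o (fun x => f x + 1)).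
  have I1 : mu.-integrable [set: T] (EFin \o cst 1).
    by apply: (@bounded_integrable 1 1) => // x; rewrite lexx.
  exact: (integrableD measurableT If I1).
have [//|//||//||_ _ H] := @dominated_convergence _ _ _ mu [set: T] measurableT
  (fun n => EFin \o (fun x => clip n (f x))) (EFin \o f) (EFin \o (fun x => f x + 1)).
- by move=> n; exact/measurable_realfun.measurable_EFinP.
- exact/measurable_realfun.measurable_EFinP.
- apply: aeW => x _; apply: cvg_EFin; first by near=> n.
  exact: cvg_clip.
- apply: aeW => x n _ /=.
  by rewrite lee_fin gtr0_norm ?clip_gt0// clip_le_add1.
move: H; rewrite -/(mean mu f) mean_integrable// => H.
by apply: fine_cvg; exact: H.
Unshelve. all: by end_near. Qed.

(** Fatou's lemma handles the left-hand side, and continuity of [Phi] at the mean of [f] the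
    right-hand side. Continuity is asked only on [I] and along positive sequences, as [clip] is
    positive. *)
Lemma mean_le_of_clip (Phi : R -> R) (I : set R) f (C : R) :
  measurable_fun [set: T] f -> (forall x, 0 <= f x) -> (mean mu f < +oo)%E ->
  measurable_fun [set: R] Phi -> (forall x, 0 <= x -> 0 <= Phi x) ->
  (forall (u : nat -> R) x, I x -> (forall n, 0 < u n) -> u n @[n --> \oo] --> x ->
     Phi (u n) @[n --> \oo] --> Phi x) ->
  (forall x, I (f x)) -> I (\int[mu]_x f x) ->
  (forall n, mean mu (fun x => Phi (clip n (f x))) <=
             (C + Phi (\int[mu]_x clip n (f x)))%:E)%E ->
  (mean mu (fun x => Phi (f x)) <= (C + Phi (\int[mu]_x f x))%:E)%E.
Proof.
move=> mf f0 foo mPhi Phi0 cPhi If Im HC.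
have mc n : measurable_fun [set: T] (fun x => clip n (f x)).
  by apply: (measurableT_comp (measurable_clip n)).
have Fatou := @fatou _ _ _ mu [set: T] measurableT
  (fun n x => (Phi (clip n (f x)))%:E).
have -> : mean mu (fun x => Phi (f x)) =
    (\int[mu]_x limn_einf (fun n => (Phi (clip n (f x)))%:E))%E.
  apply: eq_integral => x _.
  suff /cvg_limn_einf_sup[-> _ //] :
    (Phi (clip n (f x)))%:E @[n --> \oo] --> (Phi (f x))%:E.
  apply: cvg_EFin; first by near=> n.
  apply: cPhi => //; first by move=> n; exact: clip_gt0.
  exact: cvg_clip.
apply: le_trans (Fatou _ _) _.
- by move=> n; apply/measurable_realfun.measurable_EFinP; apply: (measurableT_comp mPhi).
- by move=> n x _; rewrite lee_fin Phi0// ltW// clip_gt0.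
have cvgR : (C + Phi (\int[mu]_x clip n (f x)))%:E @[n --> \oo] -->
            (C + Phi (\int[mu]_x f x))%:E.
  apply: cvg_EFin; first by near=> n.
  apply: cvgD; first exact: cvg_cst.
  apply: cPhi => // [n|]; first exact: mean_clip_gt0.
  exact: mean_cvg_clip.
rewrite limn_einf_lim -(cvg_lim _ cvgR)//; apply: lee_lim.
- exact: is_cvg_einfs.
- by apply/cvg_ex; eexists; exact: cvgR.
near=> n; apply: le_trans (HC n); apply: ereal_inf_lbound.
by exists n => /=.
Unshelve. all: by end_near. Qed.

End means.

(** * From Beckner to mLSI *)

Section bounded_exponentials.
Context (d : measure_display) (T : measurableType d) (R : realType).
Variables (mu : probability T R) (u : T -> R) (B : R).
Hypotheses (mu_ : measurable_fun [set: T] u) (uB : forall x, - B <= u x <= B).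

Lemma integrable_expR_scale (c : R) :
  mu.-integrable [set: T] (EFin \o (fun x => expR (c * u x))).
Proof.
apply: (@bounded_integrable _ _ _ _ 0 (expR (`|c| * B))) => [|x].
  apply: (measurableT_comp (@measurable_realfun.measurable_expR R)).
  exact: measurable_realfun.measurable_funM.
rewrite expR_ge0 ler_expR (le_trans (ler_norm _))// normrM ler_wpM2l//.
by rewrite ler_norml uB.
Qed.

Lemma integrable_expR : mu.-integrable [set: T] (EFin \o (fun x => expR (u x))).
Proof.
have := integrable_expR_scale 1.
by under [X in _.-integrable _ (EFin \o X)]eq_fun do rewrite mul1r.
Qed.

Lemma integrable_expR_mul :
  mu.-integrable [set: T] (EFin \o (fun x => expR (u x) * u x)).
Proof.
apply: (@bounded_integrable _ _ _ _ (- (expR B * B)) (expR B * B)) => [|x].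
  apply: measurable_realfun.measurable_funM => //.
  exact: (measurableT_comp (@measurable_realfun.measurable_expR R)).
rewrite -ler_norml normrM ger0_norm ?expR_ge0// ler_pM ?expR_ge0//.
  by rewrite ler_expR; case/andP: (uB x).
by rewrite ler_norml uB.
Qed.

Lemma mean_expR_gt0 : 0 < \int[mu]_x expR (u x).
Proof.
apply: (@lt_le_trans _ _ (expR (- B))); first exact: expR_gt0.
apply: Rintegral_ge integrable_expR _ => x.
by rewrite ler_expR; case/andP: (uB x).
Qed.

Lemma expR_powR (c x : R) : expR x `^ c = expR (c * x).
Proof. by rewrite /powR gt_eqF ?expR_gt0// expRK. Qed.

Lemma pEnt_expR (c : R) : pEnt mu c (fun x => expR (u x)) =
  (\int[mu]_x expR (c * u x) - expR (c * ln (\int[mu]_x expR (u x))))%:E.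
Proof.
rewrite /pEnt; under eq_fun do rewrite expR_powR.
rewrite mean_integrable ?integrable_expR_scale//.
rewrite mean_integrable ?integrable_expR// poweR_EFin.
by rewrite -expR_powR lnK// posrE mean_expR_gt0.
Qed.

Lemma Ent_expR : Ent mu (fun x => expR (u x)) =
  (\int[mu]_x (expR (u x) * u x) -
   (\int[mu]_x expR (u x)) * ln (\int[mu]_x expR (u x)))%:E.
Proof.
rewrite /Ent; under eq_fun do rewrite expRK.
rewrite mean_integrable ?integrable_expR_mul//.
by rewrite mean_integrable ?integrable_expR// lne_EFin ?mean_expR_gt0.
Qed.

End bounded_exponentials.

Section beckner_to_mlsi.
Context (d : measure_display) (T : measurableType d) (R : realType).
Variables (mu : probability T R).
Variables (Dom : set (T -> R)) (E : (T -> R) -> (T -> R) -> R).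
Hypotheses (hE : symmetric_nonneg_form Dom E) (hA : assumptionA Dom E).
Implicit Types (f g u : T -> R).

Lemma lty_of_max (c : R) f : measurable_fun [set: T] f -> (forall x, 0 <= f x) ->
  (mean mu (fun x => Num.max (f x) c) < +oo)%E -> (mean mu f < +oo)%E.
Proof.
move=> mf f0; apply: le_lt_trans; apply: le_mean => // [|x].
  exact: measurable_realfun.measurable_maxr.
by rewrite le_max lexx.
Qed.

(** With [g = max f e], [ln g >= 1] gives [g <= g * ln g]. If the mean of [g] were infinite, [Ent g]
    would be [+oo - +oo], against the well-definedness part of the inequality. *)
Lemma mLSI_mean_lty rho f : mLSI mu Dom E rho -> Dom f -> (forall x, 0 <= f x) ->
  (mean mu f < +oo)%E.
Proof.
move=> H Df f0; have mf := form_measurable hE Df.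
apply: (@lty_of_max (expR 1)) => //; set g := fun x => _.
have g1 x : expR 1 <= g x by rewrite le_max lexx orbT.
have g0 x : 0 < g x by apply: lt_le_trans (g1 x); exact: expR_gt0.
have Dg : Dom g by exact: (dom_max hE hA).
have Dlg : Dom (fun x => ln (g x)) by apply: (dom_ln hE hA (expR_gt0 1)).
have [+ _] := H g Dg g0 Dlg.
rewrite /Ent_defined ltey; apply: contraTneq => goo.
have -> : mean mu (fun x => g x * ln (g x)) = +oo%E.
  apply/eqP; rewrite -leye_eq -goo; apply: le_mean => // [||x|x].
  - exact: (form_measurable hE).
  - apply: measurable_realfun.measurable_funM; exact: (form_measurable hE).
  - exact: ltW.
  - rewrite ler_peMr ?(ltW (g0 x))//.
    by rewrite -[leLHS]expRK ler_ln ?posrE ?expR_gt0.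
by rewrite goo [lne _]/= mulyy.
Qed.

(** The same argument with [g = max f 1], for which [g <= g^p]; the level 1 also puts [g^(p - 1)] in
    [Dom], the power being Lipschitz there. *)
Lemma Beckner_mean_lty p a f : 1 < p <= 2 -> Beckner mu Dom E p a -> Dom f ->
  (forall x, 0 <= f x) -> (mean mu f < +oo)%E.
Proof.
move=> /andP[p1 p2] H Df f0; have mf := form_measurable hE Df.
apply: (@lty_of_max 1) => //; set g := fun x => _.
have g1 x : 1 <= g x by rewrite le_max lexx orbT.
have Dg : Dom g by exact: (dom_max hE hA).
have Dpg : Dom (fun x => g x `^ (p - 1)) by apply: (dom_powR hE hA) => //; lra.
have [+ _] := H g Dg (fun x => le_trans ler01 (g1 x)) Dpg.
rewrite /pEnt_defined ltey; apply: contraTneq => goo.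
have mg := form_measurable hE Dg.
have -> : mean mu (fun x => g x `^ p) = +oo%E.
  apply/eqP; rewrite -leye_eq -goo; apply: le_mean => // [|x|x].
  - apply: (@measurableT_comp _ _ _ _ _ _ ((@powR R)^~ p)) => //.
  - exact: le_trans ler01 (g1 x).
  - by apply: le1r_powR => //; exact: ltW.
rewrite goo /= gt_eqF//; lra.
Qed.

(** Both sides are estimated by multiples of [eps], which cancels. On the left, [expR_mul_ge] under
    the integral and [expR_mul_le] at [l] share the term [expR l], the mean of [expR (u x)]. *)
Lemma Beckner_bounded eps a B u : 0 < eps -> 0 <= a -> Dom u ->
  (forall x, - B <= u x <= B) -> Beckner mu Dom E (1 + eps) a ->
  let l := ln (\int[mu]_x expR (u x)) in
  a * (\int[mu]_x (expR (u x) * u x) - expR ((1 + eps) * l) * l) <=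
  (1 + eps) / 2 * expR (eps * B) * E (fun x => expR (u x)) u.
Proof.
move=> e0 a0 Du uB H /=; set l := ln _; have mu_ := form_measurable hE Du.
have uleB x : u x <= B by have /andP[] := uB x.
have Deu : Dom (fun x => expR (u x)) by exact: (dom_expR hE hA uleB).
have Deeu : Dom (fun x => expR (eps * u x)).
  apply: (@dom_expR _ _ _ _ _ hE hA (eps * B)); last exact: (dom_scale hE).
  by move=> x; rewrite ler_pM2l.
have powE : (fun x => expR (u x) `^ (1 + eps - 1)) = (fun x => expR (eps * u x)).
  by apply/funext => x; rewrite expR_powR addrAC subrr add0r.
have [_] := H _ Deu (fun x => expR_ge0 _) (eq_ind_r Dom Deeu powE).
rewrite powE (pEnt_expR mu mu_ uB) -/l lee_fin => HB.
have HE : E (fun x => expR (u x)) (fun x => expR (eps * u x)) <=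
    eps * expR (eps * B) * E (fun x => expR (u x)) u.
  by apply: (form_le_scale hE hA) => // x y; apply: expR_ln_two_point_le => //; exact: ltW.
have Ie := integrable_expR mu mu_ uB.
have Iep := integrable_expR_scale mu mu_ uB (1 + eps).
have Ieu := integrable_expR_mul mu mu_ uB.
have lE : expR l = \int[mu]_x expR (u x) by rewrite lnK// posrE (mean_expR_gt0 mu mu_ uB).
have H1 : eps * (\int[mu]_x (expR (u x) * u x)) <=
    \int[mu]_x expR ((1 + eps) * u x) - expR l.
  rewrite lE -RintegralZl// -RintegralB//; apply: le_Rintegral => //.
  - exact: (integrableZl measurableT eps Ieu).
  - exact: (integrableB measurableT Iep Ie).
  - by move=> x _; exact: expR_mul_ge.
have H2 := expR_mul_le eps l.
have H3 : a * (eps * (\int[mu]_x (expR (u x) * u x) - expR ((1 + eps) * l) * l)) <=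
  (1 + eps) / 2 * (eps * expR (eps * B) * E (fun x => expR (u x)) u).
  apply: (@le_trans _ _ (a * (\int[mu]_x expR ((1 + eps) * u x) - expR ((1 + eps) * l)))).
    by rewrite ler_wpM2l//; lra.
  apply: le_trans HB _; rewrite ler_wpM2l//; lra.
by rewrite -(ler_pM2l e0); move: H3; rewrite !mulrA; lra.
Qed.

(** By contradiction: the difference [G] of the two sides of [Beckner_bounded] is continuous in
    [eps]. Negative at [0], it would stay negative at some small [eps] where Beckner holds. *)
Lemma Beckner_bounded_Ent a B u : 0 <= a -> Dom u ->
  (forall x, - B <= u x <= B) ->
  (forall e, 0 < e -> exists eps, 0 < eps < e /\ Beckner mu Dom E (1 + eps) a) ->
  let m := \int[mu]_x expR (u x) in
  a * (\int[mu]_x (expR (u x) * u x) - m * ln m) <= E (fun x => expR (u x)) u / 2.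
Proof.
move=> a0 Du uB H /=; set m := \int[mu]_x expR (u x); have mu_ := form_measurable hE Du.
rewrite leNgt; apply/negP => Hlt.
set l := ln m; set Q := \int[mu]_x _ in Hlt; set EE := E _ _ in Hlt.
pose G (eps : R) := (1 + eps) / 2 * expR (eps * B) * EE -
                    a * (Q - expR ((1 + eps) * l) * l).
have G0 : G 0 < 0.
  rewrite /G mul0r expR0 !addr0 mul1r mulr1 mul1r lnK ?posrE ?(mean_expR_gt0 mu mu_ uB)//.
  rewrite subr_lt0; move: Hlt; rewrite -/l; lra.
have cG : G eps @[eps --> 0] --> G 0.
  have c1 (c k : R) : expR ((k + eps) * c) @[eps --> 0] --> expR ((k + 0) * c).
    apply: (@cvg_comp _ _ _ (fun eps : R => (k + eps) * c) expR _ _ _ _ (@continuous_expR R _)).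
    by apply: cvgMl; apply: cvgD; [exact: cvg_cst|exact: cvg_id].
  apply: cvgB.
    apply: cvgMl; apply: cvgM; last first.
      by have := c1 B 0; under eq_cvg do rewrite add0r; rewrite add0r.
    by apply: cvgMl; apply: cvgD; [exact: cvg_cst|exact: cvg_id].
  by apply: cvgMr; apply: cvgB; [exact: cvg_cst|apply: cvgMl; exact: c1].
have [e /= e0 He] : nbhs_ball (0 : R) [set eps | G eps < 0].
  by apply/nbhs_ballP; exact: (cvgr_lt _ cG _ G0).
have [eps [/andP[eps0 epse] HB]] := H e e0.
have := He eps; rewrite /= /ball /= sub0r normrN gtr0_norm// => /(_ epse).
move=> Glt; have /= := Beckner_bounded eps0 a0 Du uB HB.
by apply/negP; rewrite -ltNge -subr_lt0; exact: Glt.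
Qed.

End beckner_to_mlsi.

(** * Removal of the boundedness assumption *)

Section beckner_to_mlsi_general.
Context (d : measure_display) (T : measurableType d) (R : realType).
Variables (mu : probability T R).
Implicit Types (f g u : T -> R).

Lemma Rintegral_psi g : mu.-integrable [set: T] (EFin \o g) ->
  mu.-integrable [set: T] (EFin \o (fun x => g x * ln (g x))) ->
  mu.-integrable [set: T] (EFin \o (fun x => psi (g x))) /\
  \int[mu]_x psi (g x) = \int[mu]_x (g x * ln (g x)) - \int[mu]_x g x + 1.
Proof.
move=> Ig Igl; have I1 : mu.-integrable [set: T] (EFin \o cst 1).
  by apply: (@bounded_integrable _ _ _ _ 1 1) => // x; rewrite lexx.
have IB := integrableB measurableT Igl Ig.
split; first exact: (integrableD measurableT IB I1).
rewrite -(Rintegral_probability_cst mu 1) -RintegralB// -RintegralD//.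
Qed.

(** Unlike [x * ln x], [psi] is nonnegative and thus suited to Fatou's lemma; the integrability
    obtained for it is transferred back here. *)
Lemma integrable_mul_ln g : mu.-integrable [set: T] (EFin \o g) ->
  mu.-integrable [set: T] (EFin \o (fun x => psi (g x))) ->
  mu.-integrable [set: T] (EFin \o (fun x => g x * ln (g x))).
Proof.
move=> Ig Ip; have I1 : mu.-integrable [set: T] (EFin \o cst 1).
  by apply: (@bounded_integrable _ _ _ _ 1 1) => // x; rewrite lexx.
have := integrableB measurableT (integrableD measurableT Ip Ig) I1.
apply: eq_integrable => // x _.
by apply: (f_equal EFin); rewrite /psi /=; ring.
Qed.

(** A zero integral would force [f = 0] almost everywhere, making the whole space negligible. *)
Lemma Rintegral_gt0 f : mu.-integrable [set: T] (EFin \o f) ->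
  (forall x, 0 < f x) -> 0 < \int[mu]_x f x.
Proof.
move=> If f0; rewrite lt_neqAle Rintegral_ge0 ?andbT => [|x _]; last exact: ltW.
rewrite eq_sym; apply/eqP => i0.
have /integrableP[mf _] := If.
have : (\int[mu]_x `|(EFin \o f) x|)%E = 0%E.
  under eq_integral do rewrite /= gtr0_norm//.
  by have := mean_integrable If; rewrite i0.
move=> /(ae_eq_integral_abs mu measurableT mf) [N [mN N0 sN]].
have : mu [set: T] = 0%E.
  apply/eqP; rewrite eq_le measure_ge0 andbT -N0 le_measure ?inE//.
  apply: subset_trans sN => x _ /= /(_ Logic.I) [] fx.
  by have := f0 x; rewrite fx ltxx.
by rewrite probability_setT => /eqP; rewrite onee_eq0.
Qed.

Lemma measurable_psi : measurable_fun [set: R] (@psi R).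
Proof.
apply: measurable_realfun.measurable_funD; last exact: measurable_cst.
apply: measurable_realfun.measurable_funB; last exact: measurable_id.
by apply: measurable_realfun.measurable_funM.
Qed.

Lemma psi_cvg (u : nat -> R) (x : R) : 0 < x -> u n @[n --> \oo] --> x ->
  psi (u n) @[n --> \oo] --> psi x.
Proof.
move=> x0 ux; apply: cvgD; last exact: cvg_cst.
apply: cvgB => //; apply: cvgM => //.
exact: (@cvg_comp _ _ _ u (@ln R) _ _ _ ux (continuous_ln x0)).
Qed.

Variables (Dom : set (T -> R)) (E : (T -> R) -> (T -> R) -> R).
Hypotheses (hE : symmetric_nonneg_form Dom E) (hA : assumptionA Dom E).

Lemma ln_clip_bound n (x : R) :
  - ln n.+1%:R <= ln (clip n x) <= ln (n.+1%:R : R).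
Proof.
have N0 : 0 < n.+1%:R :> R by [].
rewrite -lnV ?posrE// !ler_ln ?posrE ?clip_gt0 ?invr_gt0//.
by rewrite clip_ge clip_le.
Qed.

Lemma Beckner_mLSI a : 0 < a ->
  (forall e, 0 < e -> exists eps, 0 < eps < e /\ Beckner mu Dom E (1 + eps) a) ->
  mLSI mu Dom E (2 * a).
Proof.
move=> a0 H f Df f0 Dlf; have mf := form_measurable hE Df.
have f0' x : 0 <= f x by exact: ltW.
have foo : (mean mu f < +oo)%E.
  have [eps [/andP[e0 e1] HB]] := H 1 ltr01.
  by apply: (Beckner_mean_lty hE hA _ HB) => //; lra.
have If := integrable_mean mf f0' foo.
have m0 := Rintegral_gt0 If f0.
set m := \int[mu]_x f x in m0.
pose EE := E f (fun x => ln (f x)).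
(* The mean of [psi f] minus [psi m] is exactly the entropy of [f], the affine part of [psi]
   cancelling. *)
have Hpsi : (mean mu (fun x => psi (f x)) <= (EE / (2 * a) + psi m)%:E)%E.
  apply: (@mean_le_of_clip _ _ _ mu (@psi R) [set x | 0 < x]) => //.
  - exact: measurable_psi.
  - exact: psi_ge0.
  - by move=> u x /= x0 _; exact: psi_cvg.
  move=> n; pose u x := ln (clip n (f x)).
  have uE : (fun x => clip n (f x)) = (fun x => expR (u x)).
    by apply/funext => x; rewrite lnK// posrE clip_gt0.
  have Dc : Dom (fun x => clip n (f x)).
    by apply: (dom_max hE hA); exact: (dom_min hE hA).
  have Du : Dom u.
    apply: (@dom_ln _ _ _ _ _ hE hA n.+1%:R^-1) => // x.
    exact: clip_ge.
  have mu_ := form_measurable hE Du.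
  have uB x : - ln n.+1%:R <= u x <= ln n.+1%:R by exact: ln_clip_bound.
  have /= := Beckner_bounded_Ent hE hA (ltW a0) Du uB H.
  have : E (fun x => expR (u x)) u <= EE.
    rewrite -uE; apply: (assumptionA_le hA) => // x y.
    apply: (@comp_clip_two_point_le _ [set x | 0 < x]) => //=.
    by move=> b c /= b0 c0 bc; rewrite ler_ln.
  have Ie := integrable_expR mu mu_ uB.
  have Ieu := integrable_expR_mul mu mu_ uB.
  have Igl : mu.-integrable [set: T] (EFin \o (fun x => expR (u x) * ln (expR (u x)))).
    by move: Ieu; apply: eq_integrable => // x _ /=; rewrite expRK.
  have [Ip psiE] := Rintegral_psi Ie Igl.
  rewrite uE; have -> : (fun x => psi (clip n (f x))) = (fun x => psi (expR (u x))).
    by apply/funext => x; rewrite -[clip _ _]/((fun x => clip n (f x)) x) uE.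
  rewrite mean_integrable// lee_fin psiE /psi.
  under [X in _ -> _ -> X - _ + _ <= _]eq_Rintegral do rewrite expRK.
  set M := \int[mu]_x expR (u x); set Q := Rintegral _ _ _.
  move=> H1 H2; have H3 : Q - M * ln M <= EE / (2 * a).
    rewrite ler_pdivlMr ?mulr_gt0//; lra.
  lra.
have mpsi : measurable_fun [set: T] (fun x => psi (f x)).
  exact: (measurableT_comp measurable_psi).
have Ipsi : mu.-integrable [set: T] (EFin \o (fun x => psi (f x))).
  apply: integrable_mean => // [x|]; first exact: psi_ge0.
  exact: le_lt_trans Hpsi (ltry _).
have Ifl := integrable_mul_ln If Ipsi.
have [_ psiE] := Rintegral_psi If Ifl.
split; first by rewrite /Ent_defined fin_num_adde_defr// mean_integrable.
rewrite /Ent !mean_integrable// -/m lne_EFin//. 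
rewrite -(EFinM m) -EFinB -EFinM lee_fin.
move: Hpsi; rewrite mean_integrable// lee_fin psiE -/m /psi.
set Q := Rintegral _ _ _ => HQ.
have : Q - m * ln m <= EE / (2 * a) by lra.
by rewrite ler_pdivlMr ?mulr_gt0// mulrC.
Qed.

End beckner_to_mlsi_general.

(** * From mLSI to Beckner *)

Section mlsi_to_beckner.
Context (d : measure_display) (T : measurableType d) (R : realType).
Variables (mu : probability T R).
Variables (Dom : set (T -> R)) (E : (T -> R) -> (T -> R) -> R).
Hypotheses (hE : symmetric_nonneg_form Dom E) (hA : assumptionA Dom E).
Implicit Types (f g u : T -> R) (eps D B : R).

(** The logarithm of the truncated [F (c f)] of the header, with [f = e^u] and [c = e^tau]. *)
Definition log_link eps D u (tau : R) (x : T) : R :=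
  ln (link eps (Num.max (u x + tau) (- D))).

Lemma expR_log_link eps D u tau x :
  expR (log_link eps D u tau x) = link eps (Num.max (u x + tau) (- D)).
Proof. by rewrite lnK// posrE link_gt0. Qed.

Lemma dom_log_link eps D u tau : 0 <= eps -> Dom u -> Dom (log_link eps D u tau).
Proof.
move=> e0 Du; apply: (dom_ln_link hE hA) => //.
by apply: (dom_max hE hA); exact: (dom_addr hE hA).
Qed.

Lemma log_link_bounded eps D u B tau : 0 <= eps -> (forall x, - B <= u x <= B) ->
  exists B', forall x, - B' <= log_link eps D u tau x <= B'.
Proof.
move=> e0 uB; pose W1 := - D; pose W2 := Num.max (B + tau) (- D).
exists (Num.max `|ln (link eps W1)| `|ln (link eps W2)|) => x.
have w1 : W1 <= Num.max (u x + tau) (- D) by rewrite le_max lexx orbT.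
have w2 : Num.max (u x + tau) (- D) <= W2.
  rewrite ge_max !le_max lexx orbT andbT lerD2r.
  by case/andP: (uB x) => _ ->.
have /andP[+ _] := ln_link_lip e0 w1; have /andP[+ _] := ln_link_lip e0 w2.
rewrite !subr_ge0 -/(log_link eps D u tau x) => H2 H1.
rewrite -ler_norml le_max !ler_normr !ler_norml.
by case: (leP 0 (log_link eps D u tau x)) => ?; lra.
Qed.

Lemma log_link_shift eps D u t t' x : 0 <= eps -> t <= t' ->
  0 <= log_link eps D u t' x - log_link eps D u t x <= (1 + eps) * (t' - t).
Proof.
move=> e0 tt'; have utt' : u x + t <= u x + t' by rewrite lerD2l.
have /andP[w0 w1] := max_contraction (- D) utt'.
have /andP[H0 H1] := @ln_link_lip _ eps _ _ e0 (ltac:(by rewrite -subr_ge0; exact: w0)).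
rewrite H0/=; apply: le_trans H1 _; rewrite ler_wpM2l//; lra.
Qed.

(** The intermediate value theorem, applied to the logarithm of the mean as a function of [tau]; by
    [log_link_shift] it is nondecreasing and Lipschitz. *)
Lemma exists_normalization eps D u B : 0 < eps -> 0 <= D -> Dom u ->
  (forall x, - B <= u x <= B) ->
  exists tau, \int[mu]_x expR (log_link eps D u tau x) = 1.
Proof.
move=> e0 D0 Du uB; pose N tau := \int[mu]_x expR (log_link eps D u tau x).
have Int tau : mu.-integrable [set: T] (EFin \o (fun x => expR (log_link eps D u tau x))).
  have [B' vB] := log_link_bounded D tau (ltW e0) uB.
  apply: (integrable_expR mu _ vB); apply: (form_measurable hE).
  by apply: dom_log_link => //; exact: ltW.
have N0 tau : 0 < N tau by apply: Rintegral_gt0 => // x; exact: expR_gt0.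
have L1 t t' : t <= t' -> 0 <= ln (N t') - ln (N t) <= (1 + eps) * (t' - t).
  move=> tt'; have H x := log_link_shift D u x (ltW e0) tt'.
  rewrite subr_ge0 ler_ln ?posrE//; apply/andP; split.
    apply: le_Rintegral => // x _; rewrite ler_expR -subr_ge0.
    by case/andP: (H x).
  rewrite lerBlDr -[X in X + _]expRK -lnM ?posrE ?expR_gt0//.
  rewrite ler_ln ?posrE ?mulr_gt0 ?expR_gt0// -RintegralZl//.
  apply: le_Rintegral => //; first exact: (integrableZl measurableT _ (Int t)).
  move=> x _; rewrite -expRD ler_expR; case/andP: (H x) => _; lra.
have cL : continuous (fun t => ln (N t)).
  move=> t; apply/cvgrPdist_lt => e e_gt0; near=> t'.
  apply: (@le_lt_trans _ _ ((1 + eps) * `|t - t'|)).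
    have [tt'|/ltW tt'] := leP t t'.
      have /andP[H1 H2] := L1 _ _ tt'.
      by rewrite distrC (distrC t) (ger0_norm H1) ger0_norm ?subr_ge0.
    have /andP[H1 H2] := L1 _ _ tt'.
    by rewrite (ger0_norm H1) ger0_norm ?subr_ge0.
  rewrite -ltr_pdivlMl; last lra.
  near: t'; apply/nbhs_ballP; exists ((1 + eps)^-1 * e) => //=.
  by rewrite mulr_gt0// invr_gt0; lra.
(* A space of total mass 1 has a point, at which the bounds on [u] give [- B <= B]. *)
have BB : - B <= B.
  rewrite leNgt; apply/negP => B0; have : mu [set: T] = 0%E.
    have -> : [set: T] = set0.
      apply/seteqP; split => // x _; case/andP: (uB x) => H1 H2.
      by have := le_trans H1 H2; rewrite leNgt B0.
    exact: measure0.
  by rewrite probability_setT => /eqP; rewrite onee_eq0.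
(* At [tau = - B] the argument of [link] is nonpositive, so its value is at most [link eps 0 = 1];
   [tau = B] is symmetric. *)
have LB0 : ln (N (- B)) <= 0.
  apply: ln_le0; apply: Rintegral_le => // x.
  rewrite expR_log_link -[leRHS]expR0 -[leRHS](_ : link eps 0 = _); last first.
    by rewrite /link mulr0 expq0 mulr1.
  have : Num.max (u x - B) (- D) <= 0.
    by rewrite ge_max subr_le0 oppr_le0 D0 andbT; case/andP: (uB x).
  by move=> /(ln_link_lip (ltW e0)) /andP[+ _]; rewrite subr_ge0 ler_ln ?posrE ?link_gt0.
have LB1 : 0 <= ln (N B).
  apply: ln_ge0; apply: Rintegral_ge => // x.
  rewrite expR_log_link -[leLHS]expR0 -[leLHS](_ : link eps 0 = _); last first.
    by rewrite /link mulr0 expq0 mulr1.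
  have : 0 <= Num.max (u x + B) (- D).
    rewrite le_max; apply/orP; left; case/andP: (uB x); lra.
  by move=> /(ln_link_lip (ltW e0)) /andP[+ _]; rewrite subr_ge0 ler_ln ?posrE ?link_gt0.
have [||tau _ Htau] := @IVT R (fun t => ln (N t)) (- B) B 0 BB.
- exact: continuous_subspaceT.
- apply/andP; split; first by rewrite ge_min; apply/orP; left.
  by rewrite le_max; apply/orP; right.
- exists tau; apply/eqP; rewrite -/(N tau) -ln_eq0//; exact/eqP.
Unshelve. all: by end_near. Qed.

(** The mLSI is applied to the normalized [expR (v x)], whose entropy is the mean of its [psi]. The
    scaling factor [expR ((1 + eps) * tau)] appears on both sides and cancels. *)
Lemma mLSI_bounded_pEnt rho eps D B u : 0 < rho -> 0 < eps -> 0 <= D -> Dom u ->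
  (forall x, - B <= u x <= B) -> mLSI mu Dom E rho ->
  rho * psi (expR (- D)) * (\int[mu]_x expR ((1 + eps) * u x) -
    expR ((1 + eps) * ln (\int[mu]_x expR (u x)))) <=
  (1 + eps) ^+ 2 * expR (eps * D) *
    E (fun x => expR (u x)) (fun x => expR (eps * u x)).
Proof.
move=> rho0 e0 D0 Du uB H; have mu_ := form_measurable hE Du.
have uleB x : u x <= B by have /andP[] := uB x.
have Deu : Dom (fun x => expR (u x)) by exact: (dom_expR hE hA uleB).
have Deeu : Dom (fun x => expR (eps * u x)).
  apply: (@dom_expR _ _ _ _ _ hE hA (eps * B)); last exact: (dom_scale hE).
  by move=> x; rewrite ler_pM2l.
have [tau N1] := exists_normalization e0 D0 Du uB.
set v := log_link eps D u tau in N1.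
have Dv : Dom v by apply: dom_log_link => //; exact: ltW.
have mv := form_measurable hE Dv.
have [B' vB] := log_link_bounded D tau (ltW e0) uB; rewrite -/v in vB.
have vleB x : v x <= B' by have /andP[] := vB x.
have Dev : Dom (fun x => expR (v x)) by exact: (dom_expR hE hA vleB).
have lnev : (fun x => ln (expR (v x))) = v by apply/funext => x; rewrite expRK.
have [_] := H _ Dev (fun x => expR_gt0 _) (eq_ind_r Dom Dv lnev).
rewrite lnev (Ent_expR mu mv vB) N1 ln1 mulr0 subr0 -EFinM lee_fin => HEnt.
have Iev := integrable_expR mu mv vB.
have Ievv : mu.-integrable [set: T] (EFin \o (fun x => expR (v x) * ln (expR (v x)))).
  move: (integrable_expR_mul mu mv vB); apply: eq_integrable => // x _ /=.
  by rewrite expRK.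
have [Ipsi] := Rintegral_psi Iev Ievv.
rewrite N1 subrK; under [X in _ = X -> _]eq_Rintegral do rewrite expRK.
move=> psiE.
have HE : E (fun x => expR (v x)) v <=
    (1 + eps) ^+ 2 * expR (eps * D) / eps * expR ((1 + eps) * tau) *
    E (fun x => expR (u x)) (fun x => expR (eps * u x)).
  apply: (form_le_scale hE hA) => // x y; rewrite !expR_log_link.
  apply: le_trans (link_max_two_point_le _ _ e0 D0) _.
  have -> : expR ((1 + eps) * tau) = expR tau * expR (eps * tau).
    by rewrite mulrDl mul1r expRD.
  rewrite !(mulrDr eps) !expRD le_eqVlt; apply/orP; left; apply/eqP.
  by field; rewrite gt_eqF.
have Ie := integrable_expR mu mu_ uB.
have Iep := integrable_expR_scale mu mu_ uB (1 + eps).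
set l := ln _; set P := \int[mu]_x expR ((1 + eps) * u x).
have lE : expR l = \int[mu]_x expR (u x) by rewrite lnK// posrE (mean_expR_gt0 mu mu_ uB).
have k0 : 0 <= psi (expR (- D)) by rewrite psi_ge0 ?expR_ge0.
(* [pow_gap_le_psi_link] is integrated at [u x + tau]. The mean of the gap exceeds the gap at
   [l + tau] by the scaled [P - expR ((1 + eps) * l)], and the latter gap is nonnegative. *)
have Hgap : psi (expR (- D)) * (expR ((1 + eps) * tau) * (P - expR ((1 + eps) * l))) <=
    eps * \int[mu]_x psi (expR (v x)).
  have gapE x : pow_gap eps (u x + tau) =
      expR ((1 + eps) * tau) * expR ((1 + eps) * u x) -
      ((1 + eps) * expR tau * expR (u x) - eps).
    by rewrite /pow_gap mulrDr !expRD; ring.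
  have Ieps : mu.-integrable [set: T] (EFin \o cst eps).
    by apply: (@bounded_integrable _ _ _ _ eps eps) => // x; rewrite lexx.
  have I1 := integrableZl measurableT (expR ((1 + eps) * tau)) Iep.
  have I2 := integrableZl measurableT ((1 + eps) * expR tau) Ie.
  have I3 := integrableB measurableT I2 Ieps.
  have I4 := integrableB measurableT I1 I3.
  apply: (@le_trans _ _ (psi (expR (- D)) * \int[mu]_x
     (expR ((1 + eps) * tau) * expR ((1 + eps) * u x) -
      ((1 + eps) * expR tau * expR (u x) - cst eps x)))).
    rewrite ler_wpM2l// RintegralB// RintegralZl// -/P RintegralB// RintegralZl//.
    rewrite Rintegral_probability_cst -lE.
    have := pow_gap_ge0 (l + tau) (ltW e0).
    rewrite /pow_gap mulrDr !expRD; lra.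
  rewrite -!RintegralZl//; apply: le_Rintegral => //.
  - exact: (integrableZl measurableT _ I4).
  - exact: (integrableZl measurableT _ Ipsi).
  move=> x _; rewrite -gapE expR_log_link; exact: pow_gap_le_psi_link.
have := ler_wpM2l (ltW rho0) Hgap; rewrite psiE.
move: HEnt; set Q := Rintegral _ _ _ => HEnt Hgap'.
have := ler_wpM2l (ltW e0) (le_trans HEnt HE).
set EE := E _ _; set et := expR ((1 + eps) * tau).
have -> : eps * ((1 + eps) ^+ 2 * expR (eps * D) / eps * et * EE) =
   et * ((1 + eps) ^+ 2 * expR (eps * D) * EE) by field; rewrite gt_eqF.
move=> HH; rewrite -(@ler_pM2l _ et) ?expR_gt0//.
move: Hgap'; rewrite -/et; lra.
Qed.

Lemma powR_cvg_nneg (p x : R) (w : nat -> R) : 0 < p -> 0 <= x ->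
  (forall n, 0 < w n) -> w n @[n --> \oo] --> x ->
  w n `^ p @[n --> \oo] --> x `^ p.
Proof.
move=> p0; rewrite le_eqVlt => /predU1P[<-|x0] w0 wx.
  rewrite powR0 ?gt_eqF//.
  by have /cvg_at_rightP := powR_cvg0 p0; apply.
have -> : (fun n => w n `^ p) = (fun n => expR (p * ln (w n))).
  by apply/funext => n; rewrite /powR gt_eqF.
have -> : x `^ p = expR (p * ln x) by rewrite /powR gt_eqF.
apply: (@cvg_comp _ _ _ (fun n => p * ln (w n)) expR _ _ _ _ (@continuous_expR R _)).
by apply: cvgMr; exact: (@cvg_comp _ _ _ w (@ln R) _ _ _ wx (continuous_ln x0)).
Qed.

(** With [p = 1 + eps], the denominator is the factor [p^2 e^(eps D)] of [mLSI_bounded_pEnt] divided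
    by the [p / 2] of Beckner. Truncations of [f] then reach the general case. *)
Lemma mLSI_Beckner rho eps D : 0 < rho -> 0 < eps <= 1 -> 0 < D ->
  mLSI mu Dom E rho ->
  Beckner mu Dom E (1 + eps)
    (rho * psi (expR (- D)) / (2 * (1 + eps) * expR (eps * D))).
Proof.
move=> rho0 /andP[e0 e1] D0 H f Df f0 Dpf.
set al := rho * _ / _.
have k0 := psi_expRN_gt0 D0.
have al0 : 0 < al by rewrite divr_gt0 ?mulr_gt0 ?expR_gt0//; lra.
have p0 : 0 < 1 + eps by lra.
have mf := form_measurable hE Df.
have foo := mLSI_mean_lty hE hA H Df f0.
have If := integrable_mean mf f0 foo.
have epsE : 1 + eps - 1 = eps by ring.
move: Dpf; rewrite epsE => Dpf.
split.
  (* The subtracted term is finite because [f] is integrable. *)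
  by rewrite /pEnt_defined (mean_integrable If) poweR_EFin fin_num_adde_defl.
pose EE := E f (fun x => f x `^ eps).
set m := \int[mu]_x f x.
have Hp : (mean mu (fun x => f x `^ (1 + eps))%R <=
           ((1 + eps) / 2 * EE / al + m `^ (1 + eps))%:E)%E.
  apply: (@mean_le_of_clip _ _ _ mu ((@powR R)^~ (1 + eps)) [set x | 0 <= x]) => //.
  - by move=> x _; exact: powR_ge0.
  - by move=> w x /= x0 w0; exact: powR_cvg_nneg.
  - exact: Rintegral_ge0.
  move=> n; pose u x := ln (clip n (f x)).
  have uE : (fun x => clip n (f x)) = (fun x => expR (u x)).
    by apply/funext => x; rewrite lnK// posrE clip_gt0.
  have Dc : Dom (fun x => clip n (f x)).
    by apply: (dom_max hE hA); exact: (dom_min hE hA).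
  have Du : Dom u.
    apply: (@dom_ln _ _ _ _ _ hE hA n.+1%:R^-1) => // x.
    exact: clip_ge.
  have mu_ := form_measurable hE Du.
  have uB x : - ln n.+1%:R <= u x <= ln n.+1%:R by exact: ln_clip_bound.
  have := mLSI_bounded_pEnt rho0 e0 (ltW D0) Du uB H.
  have : E (fun x => expR (u x)) (fun x => expR (eps * u x)) <= EE.
    have Deu : Dom (fun x => expR (eps * u x)).
      apply: (@dom_expR _ _ _ _ _ hE hA (eps * ln n.+1%:R)); last exact: (dom_scale hE).
      by move=> x; rewrite ler_pM2l//; case/andP: (uB x).
    have euE : (fun x => expR (eps * u x)) = (fun x => clip n (f x) `^ eps).
      by apply/funext => x; rewrite /powR gt_eqF ?clip_gt0.
    rewrite euE in Deu *; rewrite -uE; apply: (assumptionA_le hA) => // x y.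
    apply: (@comp_clip_two_point_le _ [set x | 0 <= x] ((@powR R)^~ eps)) => //=.
      by move=> b; exact: ltW.
    by move=> b c /= b0 c0 bc; rewrite ge0_ler_powR ?nnegrE// ltW.
  have -> : (fun x => clip n (f x) `^ (1 + eps)) = (fun x => expR ((1 + eps) * u x)).
    by apply/funext => x; rewrite /powR gt_eqF ?clip_gt0.
  rewrite uE mean_integrable; last exact: (integrable_expR_scale mu mu_ uB).
  rewrite lee_fin.
  have -> : (\int[mu]_x expR (u x)) `^ (1 + eps) =
      expR ((1 + eps) * ln (\int[mu]_x expR (u x))).
    by rewrite /powR gt_eqF// (mean_expR_gt0 mu mu_ uB).
  set P := Rintegral _ _ _; set X := expR (_ * ln _) => H1 H2.
  rewrite -lerBlDr ler_pdivlMr// /al mulrA ler_pdivrMr ?mulr_gt0 ?expR_gt0//.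
  rewrite mulrC; apply: le_trans H2 _.
  have /(ler_wpM2l (mulr_ge0 (sqr_ge0 (1 + eps)) (expR_ge0 (eps * D)))) := H1.
  by move=> /le_trans; apply; rewrite le_eqVlt; apply/orP; left; apply/eqP; field.
rewrite /pEnt (mean_integrable If) poweR_EFin -/m.
have Mfin : mean mu (fun x => f x `^ (1 + eps)) \is a fin_num.
  rewrite ge0_fin_numE; first exact: le_lt_trans Hp (ltry _).
  by apply: integral_ge0 => x _; rewrite lee_fin powR_ge0.
move: Hp; rewrite -(fineK Mfin) -EFinB -EFinM !lee_fin -/EE.
by rewrite -lerBlDr ler_pdivlMr// mulrC.
Qed.

End mlsi_to_beckner.

(** * Optimal constants *)

Section optimal_constants.
Context {R : realType}.
Implicit Types (P : R -> Prop) (c y : R).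

Lemma optimal_constant_ge0 P : (0 <= optimal_constant P)%E.
Proof. by apply: ereal_sup_ubound; exists 0 => //=; left. Qed.

Lemma le_optimal_constant P c : 0 < c -> P c -> (c%:E <= optimal_constant P)%E.
Proof. by move=> c0 Pc; apply: ereal_sup_ubound; exists c => //=; right. Qed.

Lemma optimal_constant_gt P y : 0 <= y -> (y%:E < optimal_constant P)%E ->
  exists c, [/\ 0 < c, y < c & P c].
Proof.
move=> y0 /ereal_sup_gt[_ [c /= [->|[c0 Pc]] <-]]; rewrite lte_fin => yc.
  by move: yc; rewrite ltNge y0.
by exists c.
Qed.

(** An optimal constant may be [+oo], so convergence is tested on real levels on either side of
    [l]. *)
Lemma cvg_ereal_sandwich (f : R -> \bar R) (F : set_system R) (l : \bar R) :
  Filter F -> (0 <= l)%E ->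
  (forall y : R, (y%:E < l)%E -> \forall p \near F, (y%:E <= f p)%E) ->
  (forall y : R, (l < y%:E)%E -> \forall p \near F, (f p <= y%:E)%E) ->
  f p @[p --> F] --> l.
Proof.
move=> FF; case: l => [r _ H1 H2|_ H1 _|//].
- have up := H2 (r + 1); have dn := H1 (r - 1).
  apply/fine_cvgP; split.
    near=> p; rewrite fin_numE; apply/andP; split.
      rewrite -ltNye; apply: lt_le_trans (_ : ((r - 1)%:E <= _)%E); first exact: ltNyr.
      by near: p; apply: dn; rewrite lte_fin; lra.
    rewrite -ltey; apply: (@le_lt_trans _ _ (r + 1)%:E); last exact: ltry.
    by near: p; apply: up; rewrite lte_fin; lra.
  apply/cvgrPdist_le => e e0; near=> p.
  have Hu : (f p <= (r + e)%:E)%E by near: p; apply: H2; rewrite lte_fin; lra.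
  have Hd : ((r - e)%:E <= f p)%E by near: p; apply: H1; rewrite lte_fin; lra.
  move: Hu Hd => /=; case: (f p) => // x; rewrite !lee_fin /= ler_norml => ? ?.
  lra.
- by apply/cvgeyPge => A; apply: H1; exact: ltry.
Unshelve. all: by end_near. Qed.

(** If an upper bound fails to hold eventually, it fails at points arbitrarily close to [x], which
    is the form of hypothesis [Beckner_mLSI] takes. *)
Lemma near_right_or (x : R) (Q : R -> Prop) :
  (\forall p \near x^'+, Q p) \/
  (forall e, 0 < e -> exists p, x < p < x + e /\ ~ Q p).
Proof.
have [|H] := pselect (\forall p \near x^'+, Q p); [by left|right => e e0].
apply: contrapT => Hn; apply: H; near=> p; apply: contrapT => nQ; apply: Hn.
exists p; split => //; apply/andP; split; near: p; first exact: nbhs_right_gt.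
by apply: nbhs_right_lt; rewrite ltrDl.
Unshelve. all: by end_near. Qed.

End optimal_constants.

(** * Limit of the Beckner constants and equivalence *)

Section main.
Context (d : measure_display) (T : measurableType d) (R : realType).
Variables (mu : probability T R).
Variables (Dom : set (T -> R)) (E : (T -> R) -> (T -> R) -> R).
Hypotheses (hE : symmetric_nonneg_form Dom E) (hA : assumptionA Dom E).

(** The right-hand side is nonnegative because [f] and [f^(p - 1)] vary in the same direction; the
    sign of [pEnt] is then handled by cases. *)
Lemma Beckner_le (p a a' : R) : 1 <= p -> 0 <= a <= a' ->
  Beckner mu Dom E p a' -> Beckner mu Dom E p a.
Proof.
move=> p1 /andP[a0 aa'] H f Df f0 Dpf; have [Hdef Hle] := H f Df f0 Dpf.
split=> //; have EE0 : 0 <= p / 2 * E f (fun x => f x `^ (p - 1)).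
  rewrite mulr_ge0 ?divr_ge0//; first lra.
  apply: (form_ge0_of hE hA) => // x y; wlog yx : x y / f y <= f x => [W|].
    by have [/W//|/ltW/W ?] := leP (f y) (f x); lra.
  by rewrite mulr_ge0 ?subr_ge0// ge0_ler_powR ?nnegrE// subr_ge0.
have [pE0|pE0] := leP 0%E (pEnt mu p f).
  apply: le_trans Hle; apply: lee_wpmul2r => //; by rewrite lee_fin.
apply: (@le_trans _ _ 0%E); last by rewrite lee_fin.
by apply: mule_ge0_le0; [rewrite lee_fin|exact: ltW].
Qed.

Lemma cvg_optimal_Beckner :
  optimal_constant (Beckner mu Dom E p) @[p --> 1^'+] -->
  ((2^-1)%:E * optimal_constant (mLSI mu Dom E))%E.
Proof.
apply: cvg_ereal_sandwich.
- by rewrite mule_ge0 ?optimal_constant_ge0// lee_fin.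
(* Lower bound: pick [rho > 2 * y] admissible for the mLSI, then [D] with
   [rho * psi (expR (- D)) > 2 * y]; the constant of [mLSI_Beckner] exceeds [y] for [p] near 1. *)
- move=> y ylt; have [y0|y0] := ltP y 0.
    near=> p; apply: le_trans (optimal_constant_ge0 _).
    by rewrite lee_fin ltW.
  have : ((2 * y)%:E < optimal_constant (mLSI mu Dom E))%E.
    by rewrite EFinM -lte_pdivlMl.
  have y20 : 0 <= 2 * y by lra.
  move=> /(optimal_constant_gt y20) [rho [rho0 yrho Hrho]].
  have [D D0 HD] : exists2 D, 0 < D & 2 * y / rho < psi (expR (- D)).
    by apply: psi_expRN_near1; rewrite ltr_pdivrMr// mul1r.
  rewrite ltr_pdivrMr// in HD.
  have : y * (2 * p * expR ((p - 1) * D)) @[p --> (1:R)] -->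
         y * (2 * 1 * expR ((1 - 1) * D)).
    apply: cvgMr; apply: cvgM; first by apply: cvgMr; exact: cvg_id.
    apply: (@cvg_comp _ _ _ (fun p : R => (p - 1) * D) expR _ _ _ _ (@continuous_expR R _)).
    by apply: cvgMl; apply: cvgB; [exact: cvg_id|exact: cvg_cst].
  rewrite subrr mul0r expR0 !mulr1 mulrC => /cvg_at_right_filter cvgK.
  have Hnear := cvgr_lt _ cvgK _ HD.
  near=> p.
  have p1 : 1 < p by near: p; exact: nbhs_right_gt.
  have p2 : p < 2 by near: p; apply: nbhs_right_lt; lra.
  have Kp : y * (2 * p * expR ((p - 1) * D)) < psi (expR (- D)) * rho.
    by near: p; exact: Hnear.
  have K0 : 0 < 2 * p * expR ((p - 1) * D) by rewrite mulr_gt0 ?expR_gt0//; lra.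
  have e01 : 0 < p - 1 <= 1 by lra.
  have := mLSI_Beckner hE hA rho0 e01 D0 Hrho; rewrite (addrC 1) subrK => HB.
  apply: le_trans (le_optimal_constant _ HB).
    by rewrite lee_fin ler_pdivlMr// ltW// (mulrC rho).
  by rewrite divr_gt0// mulr_gt0// psi_expRN_gt0.
(* Upper bound: if the Beckner constants exceeded [y] for [p] arbitrarily close to 1, the mLSI would
   hold with [2 * y], beyond its optimal constant. *)
- move=> y lty.
  have [//|Hex] := near_right_or 1
    (fun p => (optimal_constant (Beckner mu Dom E p) <= y%:E)%E).
  have y0 : 0 < y.
    rewrite -lte_fin; apply: le_lt_trans lty.
    by rewrite mule_ge0 ?optimal_constant_ge0// lee_fin.
  exfalso; suff : ((2 * y)%:E <= optimal_constant (mLSI mu Dom E))%E.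
    by rewrite EFinM leNgt -lte_pdivrMl// lty.
  apply: le_optimal_constant; first by rewrite mulr_gt0.
  apply: (Beckner_mLSI hE hA y0) => e e0.
  have [p [/andP[p1 pe] /negP]] := Hex e e0.
  rewrite -ltNge => /(optimal_constant_gt (ltW y0)) [c [c0 yc Hc]].
  exists (p - 1); split; first lra.
  rewrite (addrC 1) subrK; apply: Beckner_le Hc; first exact: ltW.
  by rewrite !ltW.
Unshelve. all: by end_near. Qed.

(** Take [D = 1] in [mLSI_Beckner] and bound its denominator using [p <= 2]. *)
Lemma mLSI_uniform_Beckner (rho : R) : 0 < rho -> mLSI mu Dom E rho ->
  exists2 c : R, 0 < c & forall p, 1 < p <= 2 -> Beckner mu Dom E p c.
Proof.
move=> rho0 H; have k0 := psi_expRN_gt0 (@ltr01 R).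
exists (rho * psi (expR (- 1)) / (2 * 2 * expR 1)) => [|p /andP[p1 p2]].
  by rewrite divr_gt0 ?mulr_gt0 ?expR_gt0.
have e01 : 0 < p - 1 <= 1 by lra.
have := mLSI_Beckner hE hA rho0 e01 ltr01 H; rewrite (addrC 1) subrK.
apply: Beckner_le; first exact: ltW.
rewrite divr_ge0 ?mulr_ge0 ?(ltW rho0) ?(ltW k0) ?expR_ge0//=.
have p0 : 0 < p by lra.
rewrite ler_wpM2l ?mulr_ge0 ?(ltW rho0) ?(ltW k0)//.
rewrite lef_pV2 ?posrE ?mulr_gt0 ?expR_gt0//.
by rewrite ler_pM ?mulr_ge0 ?expR_ge0 ?(ltW p0)// ?ler_pM2l// ler_expR; lra.
Qed.

End main.

Theorem theorem1p1 (d : measure_display) (T : measurableType d) (R : realType)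
    (mu : probability T R) (Dom : set (T -> R)) (E : (T -> R) -> (T -> R) -> R)
    (hE : symmetric_nonneg_form Dom E) (hA : assumptionA Dom E) :
  ((exists rho : R, 0 < rho /\ mLSI mu Dom E rho) <->
   (exists alpha : R -> R,
      (forall p : R, 1 < p <= 2 -> 0 < alpha p /\ Beckner mu Dom E p (alpha p)) /\
      0 < inf [set alpha p | p in [set p : R | 1 < p <= 2]])) /\
  (let rho_opt : \bar R := optimal_constant (mLSI mu Dom E) in
   let alpha_opt (p : R) : \bar R := optimal_constant (Beckner mu Dom E p) in
   cvg (alpha_opt p @[p --> 1^'+]) /\
   rho_opt = (2%:E * lim (alpha_opt p @[p --> 1^'+]))%E).
Proof.
split; last first.
  move=> rho_opt alpha_opt; have cvga := cvg_optimal_Beckner (mu := mu) hE hA.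
  split; first by apply/cvg_ex; eexists; exact: cvga.
  by rewrite (cvg_lim _ cvga)// muleA -EFinM divff// mul1e.
split=> [[rho [rho0 H]]|[alpha [Halpha inf0]]].
  have [c c0 Hc] := mLSI_uniform_Beckner hE hA rho0 H.
  exists (fun=> c); split; first by move=> p /Hc.
  apply: (lt_le_trans c0); apply: lb_le_inf; last by move=> _ [p _ <-].
  by exists c, 2 => //=; lra.
set i := inf _ in inf0; exists (2 * i); split; first by rewrite mulr_gt0.
apply: (Beckner_mLSI hE hA inf0) => e e0.
(* Strictly below [e], and at most 1 so that [1 + eps] stays in []1, 2]]. *)
pose eps := Num.min (e / 2) 1.
have eps01 : 0 < eps <= 1 by rewrite lt_min ge_min lexx orbT ltr01 divr_gt0.
have epse : eps < e by rewrite gt_min; apply/orP; left; lra.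
exists eps; split; first by rewrite epse andbT; case/andP: eps01.
have p12 : 1 < 1 + eps <= 2 by lra.
have [a0 HB] := Halpha _ p12; apply: Beckner_le HB => //; first lra.
(* The infimum is below each [alpha p] because the set is bounded below by [0]. *)
rewrite (ltW inf0)/=; apply: ge_inf; last by exists (1 + eps).
by exists 0 => _ [p Hp <-]; have [/ltW] := Halpha p Hp.
Qed.
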